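(* Fix a finite nonempty action set $A$. (i) For every finite nonempty $\Omega$, every prior $\mu_0$ on $\Omega$ with $\mu_0(\omega)>0$ for all $\omega$, and every finite $M$ with $|M|>\max\{|\Omega|,|A|\}$, the Lebesgue measure of the set of environments in $[0,1]^{2|A||\Omega|}$ for which commitment has no value is at least $\frac{1}{|A|^{|A|}}$. (ii) For any sequence $(\Omega_n,\mu_0^n,M_n)$ of finite state spaces with $|\Omega_n|\to\infty$, priors $\mu_0^n$ on $\Omega_n$ with full support, and finite message sets with $|M_n|>\max\{|\Omega_n|,|A|\}$, the Lebesgue measure of the set of environments in $[0,1]^{2|A||\Omega_n|}$ for which commitment has no value converges to $\frac{1}{|A|^{|A|}}$.
   Context: Given $A,\Omega,\mu_0,M$: an environment is a pair $(u_S,u_R)$ of functions $A\times\Omega\to[0,1]$, identified with a point of $[0,1]^{2|A||\Omega|}$. A messaging strategy is $\sigma:\Omega\to\Delta M$ and an action strategy is $\rho:M\to\Delta A$. For $i\in\{S,R\}$, $U_i(\sigma,\rho)=\sum_{\omega,m,a}\mu_0(\omega)\sigma(m|\omega)\rho(a|m)u_i(a,\omega)$. A profile $(\sigma,\rho)$ is S-BR if $\sigma\in\arg\max_{\sigma'}U_S(\sigma',\rho)$, and R-BR if $\rho\in\arg\max_{\rho'}U_R(\sigma,\rho')$. The persuasion payoff is the maximum of $U_S$ over R-BR profiles; the cheap-talk payoff is the maximum of $U_S$ over profiles that are both S-BR and R-BR (cheap-talk equilibria). Commitment has no value if the persuasion payoff equals the cheap-talk payoff. *)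

(* Defs.v *)
From HB Require Import structures.
From mathcomp Require Import all_boot all_order all_algebra.
From mathcomp Require Import all_classical all_reals all_analysis.

Set Implicit Arguments.
Unset Strict Implicit.
Unset Printing Implicit Defensive.

Import Order.TTheory GRing.Theory Num.Theory.
Local Open Scope classical_set_scope.
Local Open Scope ring_scope.

Section Game.
Variables (R : realType) (A Omega M : finType).

Definition is_dist (T : finType) (p : T -> R) : Prop :=
  (forall t, 0 <= p t) /\ \sum_(t : T) p t = 1.

Definition msg_strategy (sigma : Omega -> M -> R) : Prop :=
  forall w, is_dist (sigma w).
Definition act_strategy (rho : M -> A -> R) : Prop :=
  forall m, is_dist (rho m).

Definition payoff (mu0 : Omega -> R) (u : A -> Omega -> R)
    (sigma : Omega -> M -> R) (rho : M -> A -> R) : R :=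
  \sum_(w : Omega) \sum_(m : M) \sum_(a : A)
     mu0 w * sigma w m * rho m a * u a w.

Definition S_BR mu0 (uS : A -> Omega -> R) sigma rho : Prop :=
  forall sigma', msg_strategy sigma' ->
    payoff mu0 uS sigma' rho <= payoff mu0 uS sigma rho.

Definition R_BR mu0 (uR : A -> Omega -> R) sigma rho : Prop :=
  forall rho', act_strategy rho' ->
    payoff mu0 uR sigma rho' <= payoff mu0 uR sigma rho.

(* persuasion payoff: max of U_S over R-BR profiles (taken as the supremum,
   which is attained) *)
Definition persuasion_payoff mu0 (uS uR : A -> Omega -> R) : R :=
  sup [set x | exists sigma rho, [/\ msg_strategy sigma, act_strategy rho,
                 R_BR mu0 uR sigma rho & x = payoff mu0 uS sigma rho]].

Definition cheap_talk_payoff mu0 (uS uR : A -> Omega -> R) : R :=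
  sup [set x | exists sigma rho, [/\ msg_strategy sigma, act_strategy rho,
                 S_BR mu0 uS sigma rho, R_BR mu0 uR sigma rho
                 & x = payoff mu0 uS sigma rho]].

Definition commitment_no_value mu0 (uS uR : A -> Omega -> R) : Prop :=
  persuasion_payoff mu0 uS uR = cheap_talk_payoff mu0 uS uR.

End Game.

(* Coordinates of an environment: (true,(a,w)) is u_S(a,w), (false,(a,w)) is u_R(a,w).
   This index type has 2|A||Omega| elements. *)
Definition env_idx (A Omega : finType) : finType := (bool * (A * Omega))%type.

Definition env_uS {R : realType} {A Omega : finType} (e : env_idx A Omega -> R)
  : A -> Omega -> R := fun a w => e (true, (a, w)).
Definition env_uR {R : realType} {A Omega : finType} (e : env_idx A Omega -> R)
  : A -> Omega -> R := fun a w => e (false, (a, w)).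

(* Lebesgue measure of (the part inside the unit cube [0,1]^T of) a set of points
   of R^T, T finite, defined as the iterated Lebesgue integral of its indicator,
   one coordinate at a time over [0,1] (the same way the library defines the
   product measure \x^ via sections). *)
Fixpoint iter_vol {R : realType} {T : eqType} (s : seq T)
    (f : (T -> R) -> \bar R) (base : T -> R) : \bar R :=
  match s with
  | [::] => f base
  | t :: s' =>
      (\int[@lebesgue_measure R]_(x in `[0%R, 1%R]%classic)
         iter_vol s' f (fun j => if j == t then x else base j))%E
  end.

Definition cube_measure {R : realType} {T : finType} (E : set (T -> R)) : \bar R :=
  iter_vol (enum T) (fun e => ((\1_E e : R)%:E)) (fun _ => 0%R).

Definition no_value_measure {R : realType} {A Omega M : finType}
    (mu0 : Omega -> R) : \bar R :=
  cube_measure [set e : env_idx A Omega -> R |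
                 commitment_no_value M mu0 (env_uS e) (env_uR e)].

(* Main.v *)
Require Import Defs.
From HB Require Import structures.
From mathcomp Require Import all_boot all_order all_algebra.
From mathcomp Require Import all_classical all_reals all_analysis.
From mathcomp Require Import perm measurable_realfun.
From mathcomp Require Import ring lra.

Set Implicit Arguments.
Unset Strict Implicit.
Unset Printing Implicit Defensive.

Import Order.TTheory GRing.Theory Num.Theory.
Import numFieldNormedType.Exports.
Local Open Scope classical_set_scope.
Local Open Scope ring_scope.

(** The Sender attains the first best when, for each action [a], the Receiver
    is willing to play [a] on the cell of states where [a] is the Sender's
    favourite; commitment then has no value. Given the Sender's utilities,
    swapping the Receiver's utilities of two actions on a cell preserves the
    measure, so each of the [#|A| ^ #|A|] maps [c] from cells to actions is
    equally likely to list the Receiver's optimal actions. These events cover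
    the cube, and overlap in a null set when no cell is empty.

    Conversely, call a state diverse for [a != b] if [a] is clearly the favourite
    of both players while [b] is the Sender's runner-up and the Receiver's worst
    action. With many states, diverse states exist for all pairs outside a set
    of geometrically small measure. If commitment has no value, then in a nearly
    optimal equilibrium such a state almost never leads to [b]. Comparing, for
    fixed [a] and varying [b], what these states gain by mimicking each other
    shows that some message leads almost surely to [a]. As every action is
    available in this way, the Sender gets the first best, and in the limit the
    Receiver's obedience holds on each cell. *)

(** * Iterated integration over the unit cube *)

Section IteratedVolume.
Variables (R : realType) (T : eqType).
Implicit Types (f g : (T -> R) -> \bar R) (e base : T -> R) (s : seq T).
Local Open Scope ereal_scope.

Definition in_cube e := forall t, (0 <= e t <= 1)%R.

Definition upd t (x : R) e : T -> R := fun j => if j == t then x else e j.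

(* Measurability for the product sigma-algebra, tested on all measurable maps
   into [T -> R]; in this form it passes to partial integrals by Fubini-Tonelli. *)
Definition coord_measurable f := forall d (X : measurableType d) (phi : X -> T -> R),
  (forall t, measurable_fun setT (fun z => phi z t)) ->
  measurable_fun setT (fun z => f (phi z)).

Lemma in_cube_upd t x e : in_cube e -> (0 <= x <= 1)%R -> in_cube (upd t x e).
Proof. by move=> ce xI j; rewrite /upd; case: ifP. Qed.

Lemma iter_vol_cons t s f base : iter_vol (t :: s) f base =
  \int[@lebesgue_measure R]_(x in `[0%R, 1%R]%classic) iter_vol s f (upd t x base).
Proof. by []. Qed.

Lemma iter_vol_cat s1 s2 f base :
  iter_vol (s1 ++ s2) f base = iter_vol s1 (iter_vol s2 f) base.
Proof.
elim: s1 base => //= t s1 IH base.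
by apply: eq_integral => x _; rewrite IH.
Qed.

Lemma iter_vol_ge0 s f base : (forall e, 0 <= f e) -> 0 <= iter_vol s f base.
Proof.
move=> f0; elim: s base => [|t s IH] base //=.
exact: integral_ge0.
Qed.

Lemma unit_itvP (x : R) : (`[0%R, 1%R]%classic : set R) x -> (0 <= x <= 1)%R.
Proof. by rewrite /= in_itv. Qed.

(* No measurability is needed: the integral of a nonnegative function is the
   supremum of the integrals of the simple functions below it. *)
Lemma ge0_integral_mono (D : set R) (h1 h2 : R -> \bar R) :
  (forall x, D x -> 0 <= h1 x) -> (forall x, D x -> h1 x <= h2 x) ->
  \int[@lebesgue_measure R]_(x in D) h1 x <= \int[@lebesgue_measure R]_(x in D) h2 x.
Proof.
move=> h10 h12; rewrite !ge0_integralE//; last first.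
  by move=> x Dx; exact: le_trans (h10 x Dx) (h12 x Dx).
apply: le_ereal_sup => _ [h /= hle <-]; exists h => //= x.
apply: le_trans (hle x) _; rewrite /patch; case: ifP => //.
by rewrite inE => /h12.
Qed.

Lemma le_iter_vol s f g base : in_cube base -> (forall e, 0 <= f e) ->
  (forall e, in_cube e -> f e <= g e) -> iter_vol s f base <= iter_vol s g base.
Proof.
move=> cb f0 fg; elim: s base cb => [|t s IH] base cb; first exact: fg.
rewrite !iter_vol_cons; apply: ge0_integral_mono.
  by move=> x _; exact: iter_vol_ge0.
by move=> x /unit_itvP xI; apply/IH/in_cube_upd.
Qed.

Lemma measurable_phi_upd d (X : measurableType d) (phi : X -> T -> R) t :
  (forall j, measurable_fun setT (fun z => phi z j)) ->
  forall j, measurable_fun [set: X * measurableTypeR R]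
     (fun z => upd t z.2 (phi z.1) j).
Proof.
move=> mphi j; rewrite /upd; case: (j == t); first exact: measurable_snd.
exact: (measurableT_comp (mphi j) measurable_fst).
Qed.

Lemma coord_measurable_int t f : (forall e, 0 <= f e) -> coord_measurable f ->
  coord_measurable (fun e =>
    \int[@lebesgue_measure R]_(x in `[0%R, 1%R]%classic) f (upd t x e)).
Proof.
move=> f0 mf d X phi mphi.
under eq_fun do rewrite integral_mkcond.
apply: (@measurable_fun_fubini_tonelli_F _ _ X (measurableTypeR R) R
  (@lebesgue_measure R)
  (fun z => ((fun x => f (upd t x (phi z.1))) \_ `[0%R, 1%R]%classic) z.2)).
  rewrite /patch; apply: measurable_fun_ifT.
  - have -> : (fun z : X * measurableTypeR R => z.2 \in (`[0%R, 1%R]%classic : set R)) =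
      (fun z => (0 <= z.2)%R && (z.2 <= 1)%R).
      apply/funext => z; rewrite mem_setE; exact: in_itv.
    apply: measurable_and; apply: measurable_fun_ler => //; exact: measurable_snd.
  - apply: (mf _ (X * measurableTypeR R)%type (fun z => upd t z.2 (phi z.1))).
    exact: measurable_phi_upd.
  - exact: measurable_cst.
by move=> z; rewrite /patch; case: ifP.
Qed.

Lemma coord_measurable_iter_vol s f : (forall e, 0 <= f e) ->
  coord_measurable f -> coord_measurable (iter_vol s f).
Proof.
move=> f0 mf; elim: s => [|t s IH] //.
by apply: coord_measurable_int => // e; exact: iter_vol_ge0.
Qed.

Lemma coord_measurable_section t f base : coord_measurable f ->
  measurable_fun [set: measurableTypeR R] (fun x => f (upd t x base)).
Proof.
move=> mf; apply: (mf _ (measurableTypeR R) (fun x => upd t x base)) => j.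
by rewrite /upd; case: (j == t); [exact: measurable_id|exact: measurable_cst].
Qed.

Lemma upd_comm t1 t2 x1 x2 e : t1 != t2 ->
  upd t1 x1 (upd t2 x2 e) = upd t2 x2 (upd t1 x1 e).
Proof.
move=> ne; apply/funext => j; rewrite /upd.
by case: eqP => [->|//]; rewrite (negbTE ne).
Qed.

(** Tonelli's theorem for the two outermost variables, once the integrand is cut off outside the
    unit square. *)
Lemma iter_vol_swap t1 t2 s f base : t1 != t2 -> (forall e, 0 <= f e) ->
  coord_measurable f ->
  iter_vol (t1 :: t2 :: s) f base = iter_vol (t2 :: t1 :: s) f base.
Proof.
move=> ne f0 mf; rewrite !iter_vol_cons.
under eq_integral do rewrite iter_vol_cons integral_mkcond.
under [RHS]eq_integral do rewrite iter_vol_cons integral_mkcond.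
rewrite integral_mkcond [RHS]integral_mkcond.
pose D := `[0%R, 1%R]%classic : set R.
pose F (z : measurableTypeR R * measurableTypeR R) : \bar R :=
  if (z.1 \in D) && (z.2 \in D)
  then iter_vol s f (upd t2 z.2 (upd t1 z.1 base)) else 0.
have mD (z : measurableTypeR R * measurableTypeR R -> measurableTypeR R) :
    measurable_fun setT z -> measurable_fun setT (fun x => z x \in D).
  move=> mz; have -> : (fun x => z x \in D) =
      (fun x => (0 <= z x)%R && (z x <= 1)%R).
    by apply/funext => x; rewrite mem_setE; exact: in_itv.
  by apply: measurable_and; apply: measurable_fun_ler.
have mF : measurable_fun setT F.
  apply: measurable_fun_ifT; last exact: measurable_cst.
    apply: measurable_and; apply: mD; [exact: measurable_fst|exact: measurable_snd].
  apply: (@coord_measurable_iter_vol s f f0 mf _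
    (measurableTypeR R * measurableTypeR R)%type
    (fun z => upd t2 z.2 (upd t1 z.1 base))) => j.
  rewrite /upd; case: (j == t2); first exact: measurable_snd.
  by case: (j == t1); [exact: measurable_fst|exact: measurable_cst].
have F0 z : 0 <= F z by rewrite /F; case: ifP => // _; exact: iter_vol_ge0.
transitivity (\int[@lebesgue_measure R]_x \int[@lebesgue_measure R]_y F (x, y)).
  apply: eq_integral => x _; rewrite /patch /F /= -/D; case: (x \in D) => /=.
    by [].
  by rewrite integral0.
rewrite fubini_tonelli//.
apply: eq_integral => x _; rewrite /patch /F /= -/D; case: (x \in D) => /=.
  by apply: eq_integral => y _; rewrite andbT upd_comm// eq_sym.
rewrite -[RHS](integral0 (@lebesgue_measure R) setT).
by apply: eq_integral => y _; rewrite andbF.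
Qed.

(** The head of [s1] is swapped past the coordinates that precede it in [s2]; [uniq] makes each
    swapped pair distinct. *)
Lemma iter_vol_perm s1 s2 f base : perm_eq s1 s2 -> uniq s1 ->
  (forall e, 0 <= f e) -> coord_measurable f ->
  iter_vol s1 f base = iter_vol s2 f base.
Proof.
move=> p12 u1 f0 mf; elim: s1 s2 base p12 u1 => [|t s1 IH] s2 base p12 u1.
  by move: p12 => /perm_size/esym/size0nil ->.
have ts2 : t \in s2 by rewrite -(perm_mem p12) mem_head.
move: u1 => /= /andP[ts1 u1].
case/splitPr: s2 / ts2 p12 => p1 p2 p12.
have {p12}p12 : perm_eq s1 (p1 ++ p2).
  by rewrite -(perm_cons t); apply: perm_trans p12 _; rewrite -cat1s perm_catCA.
have tp : t \notin p1 by apply: contra ts1 => tp; rewrite (perm_mem p12) mem_cat tp.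
transitivity (iter_vol (t :: p1 ++ p2) f base).
  by rewrite !iter_vol_cons; apply: eq_integral => x _; exact: IH.
elim: p1 base tp {p12} => [//|r p1 IHp] base /=.
rewrite inE negb_or => /andP[tr tp].
rewrite -[LHS]/(iter_vol (t :: r :: (p1 ++ p2)) f base) iter_vol_swap//.
rewrite -[RHS]/(iter_vol (r :: (p1 ++ t :: p2)) f base) !iter_vol_cons.
by apply: eq_integral => x _; exact: IHp.
Qed.

Lemma iter_vol_reindex (h h' : T -> T) s f base : cancel h h' -> cancel h' h ->
  iter_vol s (fun e => f (e \o h)) base = iter_vol (map h' s) f (base \o h).
Proof.
move=> hK h'K; elim: s base => [//|t s IH] base.
rewrite [map _ _]/= !iter_vol_cons; apply: eq_integral => x _.
rewrite IH; congr (iter_vol _ _ _); apply/funext => j.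
by rewrite /upd /=; congr (if _ then _ else _); rewrite (can2_eq hK h'K).
Qed.

Lemma iter_volD s f g base : (forall e, 0 <= f e) -> (forall e, 0 <= g e) ->
  coord_measurable f -> coord_measurable g ->
  iter_vol s (fun e => f e + g e) base = iter_vol s f base + iter_vol s g base.
Proof.
move=> f0 g0 mf mg; elim: s base => [//|t s IH] base.
rewrite !iter_vol_cons -ge0_integralD//; last 4 first.
- by move=> x _; exact: iter_vol_ge0.
- apply: measurable_funTS; apply: coord_measurable_section; exact: coord_measurable_iter_vol.
- by move=> x _; exact: iter_vol_ge0.
- apply: measurable_funTS; apply: coord_measurable_section; exact: coord_measurable_iter_vol.
by apply: eq_integral => x _; rewrite IH.
Qed.

Lemma integral_unit_cst (c : \bar R) :
  \int[@lebesgue_measure R]_(x in `[0%R, 1%R]%classic) c = c.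
Proof.
rewrite integral_cst//= lebesgue_measure_itv/= lte_fin ltr01.
by rewrite oppr0 addr0 mule1.
Qed.

(* [c] plays the role of a constant with respect to the coordinates in [s]. *)
Lemma iter_volZ s (c : (T -> R) -> \bar R) f base :
  (forall t x e, t \in s -> c (upd t x e) = c e) ->
  (forall e, 0 <= c e) -> (forall e, 0 <= f e) -> coord_measurable f ->
  iter_vol s (fun e => c e * f e) base = c base * iter_vol s f base.
Proof.
move=> + c0 f0 mf; elim: s base => [//|t s IH] base cs.
rewrite !iter_vol_cons -ge0_integralZl//; last 2 first.
- apply: measurable_funTS; apply: coord_measurable_section; exact: coord_measurable_iter_vol.
- by move=> x _; exact: iter_vol_ge0.
apply: eq_integral => x _; rewrite IH ?cs ?mem_head// => j y e js.
by rewrite cs// inE js orbT.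
Qed.

Lemma iter_vol_cst s (c : \bar R) base : iter_vol s (fun=> c) base = c.
Proof.
elim: s base => [//|t s IH] base; rewrite iter_vol_cons.
by under eq_integral do rewrite IH; exact: integral_unit_cst.
Qed.

Lemma iter_vol_box (lo : T -> R) (l : R) s base : uniq s ->
  (0 <= l)%R -> (forall t, 0 <= lo t /\ lo t + l <= 1)%R ->
  iter_vol s (fun e => ((\prod_(t <- s) (lo t <= e t <= lo t + l)%R%:R)%R : R)%:E)
    base = (l ^+ size s)%:E.
Proof.
move=> us l0 loP.
have mbox s' : coord_measurable
    (fun e => ((\prod_(t <- s') (lo t <= e t <= lo t + l)%R%:R)%R : R)%:E).
  move=> d X phi mphi; apply/measurable_EFinP.
  elim: s' => [|t s' IH]; first by under eq_fun do rewrite big_nil; exact: measurable_cst.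
  under eq_fun do rewrite big_cons.
  apply: measurable_funM => //.
  have -> : (fun x => (lo t <= phi x t <= lo t + l)%R%:R : R) =
     (fun x => if (lo t <= phi x t <= lo t + l)%R then 1%R else 0%R).
    by apply/funext => x; case: ifP.
  apply: measurable_fun_ifT; [|exact: measurable_cst|exact: measurable_cst].
  by apply: measurable_and; apply: measurable_fun_ler => //; exact: measurable_cst.
elim: s us base => [|t s IH] us base; first by rewrite /= big_nil expr0.
move: us => /= /andP[ts us].
rewrite -[LHS]/(iter_vol (t :: s) _ base) iter_vol_cons.
transitivity (\int[@lebesgue_measure R]_(x in `[0%R, 1%R]%classic)
   ((l ^+ size s)%:E * (\1_(`[lo t, (lo t + l)%R]%classic) x)%:E)).
  apply: eq_integral => x _.
  rewrite -[RHS]muleC -(IH us (upd t x base)).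
  have -> : (\1_(`[lo t, (lo t + l)%R]%classic) x : R) = (lo t <= upd t x base t <= lo t + l)%R%:R.
    by rewrite indicE /upd eqxx mem_setE in_itv.
  rewrite -(@iter_volZ s (fun e => (((lo t <= e t <= lo t + l)%R%:R)%R : R)%:E)).
  - by congr (iter_vol _ _ _); apply/funext => e; rewrite big_cons EFinM.
  - move=> j y e js; rewrite /upd; case: eqP => // tj.
    by rewrite tj js in ts.
  - by move=> e; rewrite lee_fin ler0n.
  - by move=> e; rewrite lee_fin prodr_ge0// => j _; rewrite ler0n.
  - exact: mbox.
rewrite ge0_integralZl//; last 2 first.
- by apply/measurable_EFinP; apply: measurable_funTS; exact: measurable_indic.
- by rewrite lee_fin exprn_ge0.
rewrite integral_indic// setIidl; last first.
  have [lo0 lo1] := loP t.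
  move=> x /=; rewrite !in_itv/= => /andP[h1 h2].
  by rewrite (le_trans lo0 h1) (le_trans h2 lo1).
rewrite [X in _ * X]/= lebesgue_measure_itv/= lte_fin; case: ifP => [_|].
  by rewrite -EFinD -EFinM exprSr addrAC subrr add0r.
(* Here [l = 0]: the interval has measure zero, and so has the positive power [0 ^+ (size s).+1]. *)
rewrite ltrDl lt_neqAle l0 andbT => /negbFE/eqP <-.
by rewrite mule0 expr0n.
Qed.

End IteratedVolume.

(** * Volumes of events: additivity, null sets, independence *)

Lemma forallb_big (I : finType) (F : I -> bool) :
  [forall i, F i] = \big[andb/true]_i F i.
Proof. by rewrite big_andE; apply: eq_forallb. Qed.

Lemma natr_big_and (R : realType) (I : Type) (r : seq I) (p : pred I) (F : I -> bool) :
  (\big[andb/true]_(i <- r | p i) F i)%:R = \prod_(i <- r | p i) (F i)%:R :> R.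
Proof.
apply: (big_morph (fun b : bool => b%:R : R)) => // b b'.
by case: b; rewrite ?mul1r ?mul0r.
Qed.

Section Volume.
Variables (R : realType) (T : finType).
Implicit Types (f g : (T -> R) -> R) (P Q : (T -> R) -> bool) (e : T -> R).

Definition vol f : \bar R := iter_vol (enum T) (fun e => (f e)%:E) (fun=> 0).

Definition rmeas f := coord_measurable (fun e => (f e)%:E).

Definition bmeas P := forall d (X : measurableType d) (phi : X -> T -> R),
  (forall t, measurable_fun setT (fun z => phi z t)) ->
  measurable_fun setT (fun z => P (phi z)).

Lemma rmeasP f : rmeas f <-> forall d (X : measurableType d) (phi : X -> T -> R),
  (forall t, measurable_fun setT (fun z => phi z t)) ->
  measurable_fun setT (fun z => f (phi z)).
Proof.
by split=> mf d X phi mphi; [have /measurable_EFinP := mf _ _ _ mphi|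
  apply/measurable_EFinP; exact: mf].
Qed.

Lemma rmeas_proj t : rmeas (fun e => e t).
Proof. exact/rmeasP. Qed.

Lemma rmeas_cst c : rmeas (fun=> c).
Proof. by apply/rmeasP => d X phi mphi; exact: measurable_cst. Qed.

Lemma rmeasD f g : rmeas f -> rmeas g -> rmeas (fun e => f e + g e).
Proof.
move=> /rmeasP mf /rmeasP mg; apply/rmeasP => d X phi mphi.
by apply: measurable_funD; [exact: mf|exact: mg].
Qed.

Lemma rmeasM f g : rmeas f -> rmeas g -> rmeas (fun e => f e * g e).
Proof.
move=> /rmeasP mf /rmeasP mg; apply/rmeasP => d X phi mphi.
by apply: measurable_funM; [exact: mf|exact: mg].
Qed.

Lemma rmeas_sum (I : Type) (r : seq I) (p : pred I) (F : I -> (T -> R) -> R) :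
  (forall i, rmeas (F i)) -> rmeas (fun e => \sum_(i <- r | p i) F i e).
Proof.
move=> mF; elim: r => [|i r IH].
  by under eq_fun do rewrite big_nil; exact: rmeas_cst.
have -> : (fun e => \sum_(j <- i :: r | p j) F j e) =
    (fun e => (if p i then F i e else 0) + \sum_(j <- r | p j) F j e).
  by apply/funext => e; rewrite big_cons; case: (p i); rewrite ?add0r.
by apply: rmeasD => //; case: (p i) => //; exact: rmeas_cst.
Qed.

Lemma rmeas_ind P : bmeas P -> rmeas (fun e => (P e)%:R).
Proof.
move=> mP; apply/rmeasP => d X phi mphi.
have -> : (fun z => (P (phi z))%:R : R) = (fun z => if P (phi z) then 1 else 0).
  by apply/funext => z; case: (P _).
by apply: measurable_fun_ifT; [exact: mP|exact: measurable_cst|exact: measurable_cst].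
Qed.

Lemma bmeas_cst b : bmeas (fun=> b).
Proof. by move=> d X phi mphi; exact: measurable_cst. Qed.

Lemma bmeas_le f g : rmeas f -> rmeas g -> bmeas (fun e => f e <= g e).
Proof.
move=> /rmeasP mf /rmeasP mg d X phi mphi.
by apply: measurable_fun_ler; [exact: mf|exact: mg].
Qed.

Lemma bmeas_lt f g : rmeas f -> rmeas g -> bmeas (fun e => f e < g e).
Proof.
move=> /rmeasP mf /rmeasP mg d X phi mphi.
by apply: measurable_fun_ltr; [exact: mf|exact: mg].
Qed.

Lemma bmeas_and P Q : bmeas P -> bmeas Q -> bmeas (fun e => P e && Q e).
Proof.
by move=> mP mQ d X phi mphi; apply: measurable_and; [exact: mP|exact: mQ].
Qed.

Lemma bmeas_neg P : bmeas P -> bmeas (fun e => ~~ P e).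
Proof. by move=> mP d X phi mphi; apply: measurable_neg; exact: mP. Qed.

Lemma bmeas_eq f g : rmeas f -> rmeas g -> bmeas (fun e => f e == g e).
Proof.
move=> mf mg.
have -> : (fun e => f e == g e) = (fun e => (f e <= g e) && (g e <= f e)).
  by apply/funext => e; rewrite eq_le.
exact: (bmeas_and (bmeas_le mf mg) (bmeas_le mg mf)).
Qed.

Lemma bmeas_forall (I : finType) (F : I -> (T -> R) -> bool) :
  (forall i, bmeas (F i)) -> bmeas (fun e => [forall i, F i e]).
Proof.
move=> mF; rewrite (eq_fun (fun e => forallb_big (fun i => F i e))).
elim: (index_enum I) => [|i r IH].
  by rewrite (eq_fun (fun e => big_nil _ _ _ _)); exact: bmeas_cst.
rewrite (eq_fun (fun e => big_cons _ _ _ _ _ _)).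
exact: (bmeas_and (mF i) IH).
Qed.

Lemma bmeas_exists (I : finType) (F : I -> (T -> R) -> bool) :
  (forall i, bmeas (F i)) -> bmeas (fun e => [exists i, F i e]).
Proof.
move=> mF.
have -> : (fun e => [exists i, F i e]) = (fun e => ~~ [forall i, ~~ F i e]).
  by apply/funext => e; rewrite negb_forall; apply: eq_existsb => i; rewrite negbK.
by apply/bmeas_neg/bmeas_forall => i; exact: bmeas_neg.
Qed.

Lemma in_cube0 : in_cube (fun=> 0 : R) (T := T).
Proof. by move=> t; rewrite lexx ler01. Qed.

Lemma vol_ge0 f : (forall e, 0 <= f e) -> (0 <= vol f)%E.
Proof. by move=> f0; apply: iter_vol_ge0 => e; rewrite lee_fin. Qed.

(** Sandwiches the indicator of the no-value event between measurable functions; the upper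
    comparison relies on utilities lying in [[0, 1]], hence the restriction to the cube. *)
Lemma le_vol f g : (forall e, 0 <= f e) -> (forall e, in_cube e -> f e <= g e) ->
  (vol f <= vol g)%E.
Proof.
move=> f0 fg; apply: le_iter_vol; first exact: in_cube0.
  by move=> e; rewrite lee_fin.
by move=> e ce; rewrite lee_fin fg.
Qed.

Lemma vol_cst c : vol (fun=> c) = c%:E.
Proof. exact: iter_vol_cst. Qed.

Lemma volD f g : (forall e, 0 <= f e) -> (forall e, 0 <= g e) ->
  rmeas f -> rmeas g -> vol (fun e => f e + g e) = (vol f + vol g)%E.
Proof.
by move=> f0 g0 mf mg; rewrite /vol -iter_volD// => e; rewrite lee_fin.
Qed.

Lemma volZ c f : 0 <= c -> (forall e, 0 <= f e) -> rmeas f ->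
  vol (fun e => c * f e) = (c%:E * vol f)%E.
Proof.
by move=> c0 f0 mf; rewrite /vol -(@iter_volZ _ _ _ (fun=> c%:E)).
Qed.

Lemma vol_sum (I : finType) (p : pred I) (F : I -> (T -> R) -> R) :
  (forall i e, 0 <= F i e) -> (forall i, rmeas (F i)) ->
  vol (fun e => \sum_(i | p i) F i e) = (\sum_(i | p i) vol (F i))%E.
Proof.
move=> F0 mF; elim: (index_enum I) => [|i r IH].
  by rewrite big_nil; under eq_fun do rewrite big_nil; exact: vol_cst.
rewrite big_cons -IH; case: ifP => pi; last first.
  by under eq_fun do rewrite big_cons pi.
under eq_fun do rewrite big_cons pi.
by rewrite volD//; [move=> e; exact: sumr_ge0|exact: rmeas_sum].
Qed.

Lemma vol_reindex (h h' : T -> T) f : cancel h h' -> cancel h' h ->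
  (forall e, 0 <= f e) -> rmeas f -> vol (fun e => f (e \o h)) = vol f.
Proof.
move=> hK h'K f0 mf; rewrite /vol.
rewrite (@iter_vol_reindex _ _ h h' _ (fun e => (f e)%:E))//.
have u : uniq [seq h' t | t <- enum T].
  by rewrite map_inj_uniq ?enum_uniq//; exact: can_inj h'K.
rewrite (_ : (fun=> 0) \o h = fun=> 0)//.
apply: iter_vol_perm => //; apply: uniq_perm; rewrite ?enum_uniq// => t.
by rewrite mem_enum; apply/mapP; exists (h t); rewrite ?mem_enum.
Qed.

(** With [t0] moved to the innermost integral, every line in that direction meets the event in at
    most one point. *)
Lemma vol_thin P t0 : bmeas P ->
  (forall e, exists x0, forall x, P (upd t0 x e) -> x = x0) ->
  vol (fun e => (P e)%:R) = 0%E.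
Proof.
move=> mP thin; pose s := rem t0 (enum T).
have ps : perm_eq (enum T) (s ++ [:: t0]).
  by apply: (perm_trans (perm_to_rem (mem_enum T t0))); rewrite perm_sym perm_catC.
rewrite /vol (iter_vol_perm _ ps (enum_uniq T))//; last exact: rmeas_ind.
rewrite iter_vol_cat -[RHS](iter_vol_cst s 0%E (fun=> 0 : R)).
congr (iter_vol _ _ _); apply/funext => e; rewrite iter_vol_cons /=.
have [x0 x0P] := thin e.
apply/eqP; rewrite eq_le integral_ge0 ?andbT; last by move=> x _; rewrite lee_fin.
apply: (@le_trans _ _ (\int[@lebesgue_measure R]_(x in `[0%R, 1%R]%classic)
   (\1_[set x0] x)%:E)%E).
  apply: ge0_integral_mono => x _; rewrite lee_fin ?ler0n// indicE ler_nat.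
  by case: (P _) (x0P x) => // /(_ isT) ->; rewrite mem_set.
rewrite integral_indic// -(lebesgue_measure_set1 x0) le_measure// ?inE//.
exact: measurableI.
Qed.

Lemma vol_exists_null (I : finType) (F : I -> (T -> R) -> bool) :
  (forall i, bmeas (F i)) -> (forall i, vol (fun e => (F i e)%:R) = 0%E) ->
  vol (fun e => [exists i, F i e]%:R) = 0%E.
Proof.
move=> mF F0; apply/eqP; rewrite eq_le vol_ge0 ?andbT; last by move=> e; rewrite ler0n.
have -> : 0%E = (\sum_i vol (fun e => (F i e)%:R : R))%E by rewrite big1.
rewrite -vol_sum//; last by move=> i; exact: rmeas_ind.
apply: le_vol => [e|e _]; first by rewrite ler0n.
case: existsP => [[i Fi]|_]; last by apply: sumr_ge0 => i _; rewrite ler0n.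
by rewrite (bigD1 i)//= Fi lerDl; apply: sumr_ge0 => j _; rewrite ler0n.
Qed.

(** Regroups the coordinates so that they can be integrated one fiber of [kap] after another. *)
Lemma perm_flatten_fibers (W : finType) (kap : T -> W) (s : seq T) (u : seq W) :
  uniq u -> perm_eq (flatten [seq [seq t <- s | kap t == w] | w <- u])
                    [seq t <- s | kap t \in u].
Proof.
elim: u => [_|w u IH /= /andP[wu uu]]; first by rewrite /= filter_pred0.
have {IH} := IH uu.
rewrite -(perm_cat2l [seq t <- s | kap t == w]) => /perm_trans; apply.
rewrite perm_sym -(perm_filterC (fun t => kap t == w) [seq t <- s | kap t \in w :: u]).
rewrite -!filter_predI.
have E1 t : (kap t == w) && (kap t \in w :: u) = (kap t == w).
  by rewrite inE; case: eqP.
have E2 t : ~~ (kap t == w) && (kap t \in w :: u) = (kap t \in u).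
  by rewrite inE; case: eqP => //= ->; rewrite (negbTE wu).
by rewrite (eq_filter E1) perm_cat2l (eq_filter E2).
Qed.

(* The fibers of [kap] are disjoint sets of coordinates, so the events of
   missing the box in each of them are independent. *)
Lemma vol_miss_boxes (W : finType) (kap : T -> W) (lo : T -> R) (l : R) n :
  0 <= l <= 1 -> (forall t, 0 <= lo t /\ lo t + l <= 1) ->
  (forall w, #|[pred t | kap t == w]| = n) ->
  (vol (fun e => [forall w, ~~ [forall t, (kap t == w) ==>
        (lo t <= e t <= lo t + l)%R]]%:R) <= ((1 - l ^+ n) ^+ #|W|)%:E)%E.
Proof.
move=> /andP[l0 l1] loP cn.
pose box w e := [forall t, (kap t == w) ==> (lo t <= e t <= lo t + l)].
pose blk w := [seq t <- enum T | kap t == w].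
have mbox w : bmeas (box w).
  apply: bmeas_forall => t; case: (kap t == w) => /=; last exact: bmeas_cst.
  by apply: bmeas_and; apply: bmeas_le; (exact: rmeas_cst || exact: rmeas_proj).
have mnbox w : rmeas (fun e => (~~ box w e)%:R) by exact/rmeas_ind/bmeas_neg.
have bound w base : iter_vol (blk w) (fun e => ((~~ box w e)%:R : R)%:E) base
    = (1 - l ^+ n)%:E.
  have H : (iter_vol (blk w) (fun e => ((~~ box w e)%:R : R)%:E) base +
        (l ^+ n)%:E = 1%:E)%E.
    have <- : size (blk w) = n.
      rewrite -(cn w) -sum1_card -sum1_size big_filter big_enum_cond/=.
      by apply: eq_bigl => t; rewrite !inE.
    rewrite -(@iter_vol_box R T lo l (blk w) base)//; last first.
      exact: filter_uniq (enum_uniq T).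
    have E e : \prod_(t <- blk w) (lo t <= e t <= lo t + l)%R%:R = (box w e)%:R :> R.
      rewrite /box forallb_big natr_big_and big_filter big_enum_cond/= big_mkcond.
      by apply: eq_bigr => t _; case: (kap t == w).
    under [X in (_ + iter_vol _ X _)%E]eq_fun do rewrite E.
    rewrite -iter_volD//; last 2 first; [exact: mnbox|exact: rmeas_ind|].
    rewrite -[RHS](iter_vol_cst (blk w) 1%:E base).
    congr (iter_vol _ _ _); apply/funext => e.
    by case: (box w e); rewrite -EFinD/= ?add0r ?addr0.
  by rewrite EFinB -H addeK.
pose s := flatten [seq blk w | w <- enum W].
have ps : perm_eq (enum T) s.
  rewrite perm_sym; apply: (perm_trans (perm_flatten_fibers _ _ (enum_uniq W))).
  by rewrite (@eq_filter _ _ predT) ?filter_predT// => t; rewrite mem_enum.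
have -> : vol (fun e => [forall w, ~~ box w e]%:R) =
  iter_vol s (fun e => (\prod_(w <- enum W) (~~ box w e)%:R : R)%:E) (fun=> 0).
  rewrite /vol (iter_vol_perm _ ps (enum_uniq T))//; last first.
    apply: (@rmeas_ind (fun e => [forall w, ~~ box w e])).
    by apply: bmeas_forall => w; exact: bmeas_neg.
  congr (iter_vol _ _ _); apply/funext => e; congr (_%:E).
  by rewrite forallb_big natr_big_and big_enum.
rewrite cardE /s {ps}.
(* Each block contributes one factor: while the remaining blocks are integrated, the factor of the
   first block stays constant. *)
elim: (enum W) (enum_uniq W) (fun=> 0 : R) in_cube0 => [|w u IH] /= uu base cb.
  by rewrite big_nil expr0.
move: uu => /andP[wu uu].
have mprod : rmeas (fun e => \prod_(v <- u) (~~ box v e)%:R).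
  elim: (u) => [|v u' IHu]; first by under eq_fun do rewrite big_nil; exact: rmeas_cst.
  rewrite (eq_fun (fun e => big_cons _ _ _ _ _ _)); exact: (rmeasM (mnbox v) IHu).
have prod0 e : 0 <= \prod_(v <- u) (~~ box v e)%:R :> R.
  by apply: prodr_ge0 => v _; rewrite ler0n.
have prodE : (fun e => (\prod_(v <- w :: u) (~~ box v e)%:R : R)%:E) =
    (fun e => ((~~ box w e)%:R : R)%:E * (\prod_(v <- u) (~~ box v e)%:R : R)%:E)%E.
  by apply/funext => e; rewrite big_cons EFinM.
rewrite {}prodE iter_vol_cat exprS EFinM -(bound w base) muleC.
have q0 : 0 <= (1 - l ^+ n) ^+ size u by rewrite exprn_ge0// subr_ge0 exprn_ile1.
rewrite -(@iter_volZ _ _ _ (fun=> ((1 - l ^+ n) ^+ size u)%:E)); last 4 first.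
- by [].
- by move=> e; rewrite lee_fin.
- by move=> e; rewrite lee_fin ler0n.
- exact: mnbox.
apply: le_iter_vol => // [e|e ce].
  by apply: iter_vol_ge0 => e'; rewrite -EFinM lee_fin mulr_ge0// ler0n.
rewrite (@iter_volZ _ _ _ (fun e => ((~~ box w e)%:R : R)%:E)); last 4 first.
- move=> t x e' /flatten_mapP[v vu]; rewrite mem_filter => /andP[/eqP tv _].
  congr (nat_of_bool (~~ _))%:R%:E; apply: eq_forallb => t'.
  rewrite /upd; case: (t' =P t) => // ->; case: eqP => //= tw.
  by move: wu; rewrite -tw tv vu.
- by move=> e'; rewrite lee_fin ler0n.
- by move=> e'; rewrite lee_fin.
- exact: mprod.
by rewrite muleC lee_wpmul2r ?lee_fin ?ler0n// IH.
Qed.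

End Volume.

(** * Outcomes, incentive constraints and the revelation principle *)

Section Outcomes.
Variables (R : realType) (A Omega M : finType).
Implicit Types (mu : Omega -> R) (u : A -> Omega -> R) (r : Omega -> A -> R).
Implicit Types (sigma : Omega -> M -> R) (rho : M -> A -> R).

(** The conditional law of the action given the state; payoffs depend on a profile only through
    it. *)
Definition outcome sigma rho : Omega -> A -> R :=
  fun w a => \sum_m sigma w m * rho m a.

Definition value mu u r := \sum_w \sum_a mu w * r w a * u a w.

(** When told to play [a], the Receiver does not gain from [b]. The constraint is weighted by the
    probability of the recommendation, so it is vacuous for one that never occurs. *)
Definition obedient mu u r :=
  forall a b, 0 <= \sum_w mu w * r w a * (u a w - u b w).

(** The payoff in state [w] from mimicking state [w']. *)
Definition eu u r w w' := \sum_a r w' a * u a w.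

Lemma valueE mu u r : value mu u r = \sum_w mu w * eu u r w w.
Proof.
by apply: eq_bigr => w _; rewrite mulr_sumr; apply: eq_bigr => a _; rewrite mulrA.
Qed.

Lemma payoff_outcome mu u sigma rho :
  payoff mu u sigma rho = value mu u (outcome sigma rho).
Proof.
apply: eq_bigr => w _; rewrite exchange_big/=; apply: eq_bigr => a _.
rewrite mulr_sumr mulr_suml; apply: eq_bigr => m _.
by rewrite !mulrA.
Qed.

Lemma outcome_dist sigma rho : msg_strategy sigma -> act_strategy rho ->
  forall w, is_dist (outcome sigma rho w).
Proof.
move=> hs hr w; have [s0 s1] := hs w; split.
  by move=> a; apply: sumr_ge0 => m _; rewrite mulr_ge0// (hr m).1.
rewrite exchange_big/= -[RHS]s1; apply: eq_bigr => m _.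
by rewrite -mulr_sumr (hr m).2 mulr1.
Qed.

Lemma sum_delta (I : finType) (i0 : I) (F : I -> R) :
  \sum_i (i == i0)%:R * F i = F i0.
Proof.
rewrite (bigD1 i0)//= eqxx mul1r big1 ?addr0// => i /negbTE ->.
by rewrite mul0r.
Qed.

(** The deviation [rho'] plays [b] wherever [rho] plays [a]; its gain is the negative of the
    obedience sum. *)
Lemma R_BR_obedient mu u sigma rho : act_strategy rho ->
  R_BR mu u sigma rho -> obedient mu u (outcome sigma rho).
Proof.
move=> hr br a b; have [->|ab] := eqVneq a b.
  by rewrite big1// => w _; rewrite subrr mulr0.
pose rho' m c := rho m c + rho m a * ((c == b)%:R - (c == a)%:R).
have hr' : act_strategy rho'.
  move=> m; have [r0 r1] := hr m; split.
    move=> c; rewrite /rho'; have := r0 c; have := r0 a.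
    case: (c =P a) => [->|_]; first by rewrite (negbTE ab) /=; lra.
    by case: (c =P b) => _ /=; lra.
  rewrite big_split/= r1 -mulr_sumr sumrB.
  have E c0 : \sum_c (c == c0 :> A)%:R = 1 :> R.
    by rewrite -[RHS](sum_delta c0 (fun=> 1)); apply: eq_bigr => c _; rewrite mulr1.
  by rewrite !E subrr mulr0 addr0.
have h := br _ hr'; rewrite -subr_ge0 !payoff_outcome /value -sumrB in h.
rewrite (le_trans h)// le_eqVlt; apply/orP; left.
apply/eqP; apply: eq_bigr => w _.
have -> : \sum_c mu w * outcome sigma rho' w c * u c w =
   \sum_c mu w * outcome sigma rho w c * u c w +
   mu w * outcome sigma rho w a * (u b w - u a w).
  rewrite -(sum_delta b (fun c => u c w)) -(sum_delta a (fun c => u c w)).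
  rewrite -sumrB mulr_sumr -big_split/=; apply: eq_bigr => c _.
  have -> : outcome sigma rho' w c = outcome sigma rho w c +
      outcome sigma rho w a * ((c == b)%:R - (c == a)%:R).
    rewrite /outcome mulr_suml -big_split/=; apply: eq_bigr => m _.
    by rewrite /rho'; ring.
  ring.
ring.
Qed.

(** The Sender may copy the messages of [w'] in state [w] alone; full support lets the factor [mu w]
    be cancelled. *)
Lemma S_BR_ic mu u sigma rho : (forall w, 0 < mu w) -> msg_strategy sigma ->
  S_BR mu u sigma rho -> forall w w',
  eu u (outcome sigma rho) w w' <= eu u (outcome sigma rho) w w.
Proof.
move=> mu_gt0 hs br w w'.
pose sigma' v := if v == w then sigma w' else sigma v.
have hs' : msg_strategy sigma' by move=> v; rewrite /sigma'; case: ifP.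
have := br _ hs'; rewrite !payoff_outcome !valueE.
rewrite (bigD1 w)//= [leRHS](bigD1 w)//=.
rewrite (eq_bigr (fun v => mu v * eu u (outcome sigma rho) v v)).
  rewrite lerD2r ler_pM2l//; apply: le_trans; rewrite le_eqVlt; apply/orP; left.
  by apply/eqP; apply: eq_bigr => a _; rewrite /outcome /sigma' eqxx.
move=> v /negbTE vw; congr (_ * _); apply: eq_bigr => a _.
by rewrite /outcome /sigma' vw.
Qed.

Section Direct.
Variables (iota : A -> M) (g : M -> A).
Hypothesis iotaK : cancel iota g.

(** The message [iota a] serves as the recommendation to play [a]; [g] decodes recommendations and
    also fixes the reply to all other messages. *)
Definition direct_msg r : Omega -> M -> R :=
  fun w m => \sum_a r w a * (m == iota a)%:R.
Definition direct_act : M -> A -> R := fun m a => (a == g m)%:R.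

Lemma direct_msg_strategy r : (forall w, is_dist (r w)) ->
  msg_strategy (direct_msg r).
Proof.
move=> hr w; have [r0 r1] := hr w; split.
  by move=> m; apply: sumr_ge0 => a _; rewrite mulr_ge0// ler0n.
rewrite exchange_big/= -[RHS]r1; apply: eq_bigr => a _.
rewrite -mulr_sumr -[RHS]mulr1; congr (_ * _).
by rewrite -[RHS](sum_delta (iota a) (fun=> 1)); apply: eq_bigr => m _; rewrite mulr1.
Qed.

Lemma direct_act_strategy : act_strategy direct_act.
Proof.
move=> m; split=> [a|]; first by rewrite ler0n.
by rewrite -[RHS](sum_delta (g m) (fun=> 1)); apply: eq_bigr => a _; rewrite mulr1.
Qed.

Lemma outcome_direct_msg r rho w b :
  outcome (direct_msg r) rho w b = \sum_a r w a * rho (iota a) b.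
Proof.
rewrite /outcome /direct_msg; under eq_bigr do rewrite mulr_suml.
rewrite exchange_big/=; apply: eq_bigr => a _.
rewrite -(sum_delta (iota a) (fun m => rho m b)) mulr_sumr.
by apply: eq_bigr => m _; rewrite mulrA.
Qed.

Lemma outcome_direct r : outcome (direct_msg r) direct_act = r.
Proof.
apply/funext => w; apply/funext => b; rewrite outcome_direct_msg.
rewrite -[RHS](sum_delta b (fun a => r w a)); apply: eq_bigr => a _.
by rewrite /direct_act iotaK eq_sym mulrC.
Qed.

(** A deviation answers the recommendation [iota a] by a mixture of actions [b], and obedience makes
    [a] at least as good as each of them. *)
Lemma direct_R_BR mu u r : obedient mu u r ->
  R_BR mu u (direct_msg r) direct_act.
Proof.
move=> ob rho' hr'; rewrite !payoff_outcome outcome_direct /value.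
have -> : \sum_w \sum_a mu w * outcome (direct_msg r) rho' w a * u a w =
    \sum_a \sum_b rho' (iota a) b * \sum_w mu w * r w a * u b w.
  under eq_bigr do under eq_bigr do rewrite outcome_direct_msg mulr_sumr mulr_suml.
  under eq_bigr do rewrite exchange_big/=.
  rewrite exchange_big/=; apply: eq_bigr => a _.
  rewrite exchange_big/=; apply: eq_bigr => b _.
  by rewrite mulr_sumr; apply: eq_bigr => w _; ring.
rewrite [leRHS]exchange_big/=; apply: ler_sum => a _.
have [r0 r1] := hr' (iota a).
rewrite -[leRHS]mul1r -r1 mulr_suml; apply: ler_sum => b _.
rewrite ler_wpM2l// -subr_ge0 -sumrB; apply: le_trans (ob a b) _.
by rewrite le_eqVlt; apply/orP; left; apply/eqP; apply: eq_bigr => w _; ring.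
Qed.

End Direct.

Lemma card_le_retract : (#|A| <= #|M|)%N -> A ->
  exists (iota : A -> M) (g : M -> A), cancel iota g.
Proof.
move=> AM a0.
pose iota a := enum_val (widen_ord AM (enum_rank a)).
exists iota, (fun m => odflt a0 [pick a | iota a == m]) => a.
case: pickP => /= [b /eqP|/(_ a)]; last by rewrite eqxx.
move=> /enum_val_inj/(congr1 val)/= ?.
by apply: enum_rank_inj; apply: val_inj.
Qed.

Lemma eu_ge0_le1 u r w w' : (forall a w, 0 <= u a w <= 1) ->
  is_dist (r w') -> 0 <= eu u r w w' <= 1.
Proof.
move=> u01 [r0 r1]; apply/andP; split.
  by apply: sumr_ge0 => a _; rewrite mulr_ge0//; have /andP[] := u01 a w.
rewrite -r1; apply: ler_sum => a _; rewrite ler_piMr//.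
by have /andP[] := u01 a w.
Qed.

Lemma value_le1 mu u r : (forall a w, 0 <= u a w <= 1) -> is_dist mu ->
  (forall w, is_dist (r w)) -> value mu u r <= 1.
Proof.
move=> u01 [mu_ge0 mu1] hr; rewrite valueE -mu1; apply: ler_sum => w _.
by rewrite ler_piMr//; have /andP[] := eu_ge0_le1 w u01 (hr w).
Qed.

Lemma value_le_persuasion mu uS uR r : (#|A| <= #|M|)%N -> A ->
  (forall a w, 0 <= uS a w <= 1) -> is_dist mu ->
  (forall w, is_dist (r w)) -> obedient mu uR r ->
  value mu uS r <= persuasion_payoff M mu uS uR.
Proof.
move=> AM a0 u01 dmu hr ob; have [iota [g iotaK]] := card_le_retract AM a0.
apply: sup_upper_bound.
  split; first last.
    exists 1 => _ [sigma [rho [hs hrho _ ->]]]; rewrite payoff_outcome.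
    exact/value_le1/outcome_dist.
  exists (value mu uS r), (direct_msg iota r), (direct_act g).
  split; [exact: direct_msg_strategy|exact: direct_act_strategy|exact: direct_R_BR|].
  by rewrite payoff_outcome outcome_direct.
exists (direct_msg iota r), (direct_act g).
split; [exact: direct_msg_strategy|exact: direct_act_strategy|exact: direct_R_BR|].
by rewrite payoff_outcome outcome_direct.
Qed.

(** The action [c a] is the Receiver's best choice knowing only that the state lies in the cell of
    [a]. Obedience is the case [c = id]; the other maps serve the symmetry count. *)
Definition cell_obedient mu u (pi : {ffun Omega -> A}) (c : A -> A) :=
  [forall a, forall b,
     \sum_(w | pi w == a) mu w * u b w <= \sum_(w | pi w == a) mu w * u (c a) w].

Lemma pure_obedient mu u (pi : {ffun Omega -> A}) :
  cell_obedient mu u pi id -> obedient mu u (fun w a => (a == pi w)%:R).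
Proof.
move=> /forallP H a b; have /forallP/(_ b) := H a.
rewrite -subr_ge0 -sumrB big_mkcond/=.
move=> /le_trans; apply; rewrite le_eqVlt; apply/orP; left; apply/eqP.
apply: eq_bigr => w _; rewrite eq_sym; case: eqP => _ /=; ring.
Qed.

(** Recommending [pi w] attains the bound [le_fb], which holds for all profiles. The direct profile
    is therefore S-BR as well as R-BR, and it is the maximum in both suprema. *)
Lemma first_best_no_value mu uS uR (pi : {ffun Omega -> A}) :
  (#|A| <= #|M|)%N -> A -> (forall w, 0 <= mu w) ->
  (forall w a, uS a w <= uS (pi w) w) -> cell_obedient mu uR pi id ->
  commitment_no_value M mu uS uR.
Proof.
move=> AM a0 mu_ge0 best ob; have [iota [g iotaK]] := card_le_retract AM a0.
pose r w a : R := (a == pi w)%:R.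
have hr w : is_dist (r w).
  split=> [a|]; first by rewrite ler0n.
  by rewrite -[RHS](sum_delta (pi w) (fun=> 1)); apply: eq_bigr => a _; rewrite mulr1.
have le_fb sigma rho : msg_strategy sigma -> act_strategy rho ->
    payoff mu uS sigma rho <= value mu uS r.
  move=> hs hrho; rewrite payoff_outcome !valueE; apply: ler_sum => w _.
  rewrite ler_wpM2l// /eu sum_delta.
  have [d0 d1] := outcome_dist hs hrho w.
  rewrite -[leRHS]mul1r -d1 mulr_suml; apply: ler_sum => a _.
  by rewrite ler_wpM2l.
have hs := direct_msg_strategy iota hr.
have hrho := direct_act_strategy g.
have E : payoff mu uS (direct_msg iota r) (direct_act g) = value mu uS r.
  by rewrite payoff_outcome outcome_direct.
have sup_eq (X : set R) : X (value mu uS r) -> ubound X (value mu uS r) ->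
    sup X = value mu uS r.
  move=> Xv uX; apply/eqP; rewrite eq_le; apply/andP; split.
    by apply: ge_sup => //; exists (value mu uS r).
  by apply: sup_upper_bound => //; split; exists (value mu uS r).
rewrite /commitment_no_value /persuasion_payoff /cheap_talk_payoff !sup_eq//.
- exists (direct_msg iota r), (direct_act g); split=> //.
    by move=> sigma' hs'; rewrite E; exact: le_fb.
  by apply: direct_R_BR => //; exact: pure_obedient.
- by move=> _ [sigma [rho [? ? _ _ ->]]]; exact: le_fb.
- exists (direct_msg iota r), (direct_act g); split=> //.
  by apply: direct_R_BR => //; exact: pure_obedient.
- by move=> _ [sigma [rho [? ? _ ->]]]; exact: le_fb.
Qed.

End Outcomes.

Lemma fin_argmax (R : realType) (I : finType) (F : I -> R) : I ->
  exists i, forall j, F j <= F i.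
Proof.
move=> i0; case: (@arg_maxP _ _ I i0 xpredT F isT) => i _ H.
by exists i => j; exact: H.
Qed.

Lemma fin_pos_lbound (R : realType) (I : finType) (p : pred I) (F : I -> R) :
  (forall i, p i -> 0 < F i) -> exists2 d : R, 0 < d & forall i, p i -> d <= F i.
Proof.
move=> F0; exists (\big[Order.min/1]_(i | p i) F i).
  by apply/lt_bigmin.
by move=> i pi; exact: bigmin_le_cond.
Qed.

(** * Consequences of commitment having no value *)

Section Necessity.
Variables (R : realType) (A Omega M : finType) (mu : Omega -> R).
Variables (uS uR : A -> Omega -> R) (a0 : A).
Hypothesis AM : (#|A| <= #|M|)%N.
Hypothesis dmu : is_dist mu.
Hypothesis mu_gt0 : forall w, 0 < mu w.
Hypothesis uS01 : forall a w, 0 <= uS a w <= 1.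
Hypothesis uR01 : forall a w, 0 <= uR a w <= 1.

(** The Receiver ignores messages and plays the action that is best under the prior. This makes the
    set under the cheap-talk supremum nonempty. *)
Lemma babbling_equilibrium : exists (sigma : Omega -> M -> R) rho,
  [/\ msg_strategy sigma, act_strategy rho, S_BR mu uS sigma rho
    & R_BR mu uR sigma rho].
Proof.
have [iota _] := card_le_retract AM a0.
have m0 := iota a0.
have [a amax] := fin_argmax (fun a => \sum_w mu w * uR a w) a0.
pose sigma (w : Omega) (m : M) : R := (m == m0)%:R.
pose rho (m : M) (c : A) : R := (c == a)%:R.
have sum_ind (I : finType) (i : I) : \sum_j (j == i)%:R = 1 :> R.
  by rewrite -[RHS](sum_delta i (fun=> 1)); apply: eq_bigr => j _; rewrite mulr1.
have hs : msg_strategy sigma.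
  by move=> w; split=> [m|]; [rewrite ler0n|exact: sum_ind].
have hr : act_strategy rho.
  by move=> w; split=> [m|]; [rewrite ler0n|exact: sum_ind].
have outE sigma' : msg_strategy sigma' ->
    outcome sigma' rho = fun (w : Omega) c => (c == a)%:R.
  move=> hs'; apply/funext => w; apply/funext => c.
  by rewrite /outcome /rho -mulr_suml (hs' w).2 mul1r.
exists sigma, rho; split=> //.
  by move=> sigma' hs'; rewrite !payoff_outcome !outE.
move=> rho' hr'; rewrite !payoff_outcome outE// /value.
have -> : outcome sigma rho' = fun w c => rho' m0 c.
  by apply/funext => w; apply/funext => c; rewrite /outcome /sigma sum_delta.
have -> : \sum_w \sum_c mu w * (c == a)%:R * uR c w = \sum_w mu w * uR a w.
  apply: eq_bigr => w _; rewrite -(sum_delta a (fun c => uR c w)) mulr_sumr.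
  by apply: eq_bigr => c _; rewrite mulrA.
rewrite exchange_big/= -[leRHS]mul1r -(hr' m0).2 mulr_suml.
apply: ler_sum => c _.
have -> : \sum_w mu w * rho' m0 c * uR c w = rho' m0 c * \sum_w mu w * uR c w.
  by rewrite mulr_sumr; apply: eq_bigr => w _; ring.
by rewrite ler_wpM2l// (hr' m0).1.
Qed.

(** The margin [4^-1] makes the Sender's gain proportional to the mass moved from [b] to [a]; the
    last two conditions keep this move compatible with obedience. *)
Definition aligned a b w :=
  [/\ a != b, uS b w + 4^-1 <= uS a w, (forall c, uR c w <= uR a w)
    & (forall c, uR b w <= uR c w)].

(* Moving mass from [b] to [a] in an aligned state preserves obedience and
   raises the Sender's payoff, so a near-optimal outcome puts little mass there. *)
Lemma no_value_near_optimal (theta : R) : 0 < theta -> commitment_no_value M mu uS uR ->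
  exists r : Omega -> A -> R,
    [/\ forall w, is_dist (r w), obedient mu uR r,
        forall w w', eu uS r w w' <= eu uS r w w
      & forall a b w, aligned a b w -> r w b <= theta].
Proof.
move=> theta0 nv.
have [d d0 dP] := fin_pos_lbound (fun w (_ : predT w) => mu_gt0 w).
(* Moving the mass [r w b] gains at least [d / 4] per unit, [d] being a lower bound of the prior;
   this slack therefore forces [r w b <= theta]. *)
have eta0 : 0 < theta * d / 4 by rewrite divr_gt0// mulr_gt0.
have hsup : has_sup [set x | exists (sigma : Omega -> M -> R) rho,
    [/\ msg_strategy sigma, act_strategy rho,
      S_BR mu uS sigma rho, R_BR mu uR sigma rho & x = payoff mu uS sigma rho]].
  split.
    have [sigma [rho [h1 h2 h3 h4]]] := babbling_equilibrium.
    by exists (payoff mu uS sigma rho), sigma, rho.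
  exists 1 => _ [sigma [rho [hs hrho _ _ ->]]]; rewrite payoff_outcome.
  exact/value_le1/outcome_dist.
have [_ [sigma [rho [hs hr sbr rbr ->]]]] := sup_adherent eta0 hsup.
(* By [nv], being nearly optimal among equilibria means being nearly optimal among all obedient
   outcomes. *)
rewrite -/(cheap_talk_payoff M mu uS uR) -nv payoff_outcome => near.
have ob := R_BR_obedient hr rbr.
have dr := outcome_dist hs hr.
exists (outcome sigma rho); split=> //.
  exact: S_BR_ic.
move: (outcome sigma rho) near ob dr => r near ob dr a b w [ab gap top bot].
pose r' v c := r v c + (v == w)%:R * r w b * ((c == a)%:R - (c == b)%:R).
have dr' v : is_dist (r' v).
  have [r0 r1] := dr v; split=> [c|].
    rewrite /r'; case: (v =P w) => [vw|_] /=; last by rewrite !mul0r addr0.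
    rewrite -vw; have := r0 c; have := r0 b.
    case: (c =P b) => [->|_]; first by rewrite eq_sym (negbTE ab) /=; lra.
    by case: (c =P a) => _ /=; lra.
  rewrite big_split/= r1 -mulr_sumr sumrB.
  have E c0 : \sum_c (c == c0 :> A)%:R = 1 :> R.
    by rewrite -[RHS](sum_delta c0 (fun=> 1)); apply: eq_bigr => c _; rewrite mulr1.
  by rewrite !E subrr mulr0 addr0.
have ob' : obedient mu uR r'.
  move=> c c'.
  have -> : \sum_v mu v * r' v c * (uR c v - uR c' v) =
     \sum_v mu v * r v c * (uR c v - uR c' v) +
     mu w * r w b * ((c == a)%:R - (c == b)%:R) * (uR c w - uR c' w).
    rewrite -(sum_delta w (fun v => mu v * r w b * ((c == a)%:R - (c == b)%:R) *
      (uR c v - uR c' v))) -big_split/=.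
    by apply: eq_bigr => v _; rewrite /r'; ring.
  (* Mass is added to recommendation [a] where [a] is the Receiver's best action, and removed from
     [b] where [b] is the worst. *)
  apply: addr_ge0; first exact: ob.
  rewrite -mulrA; apply: mulr_ge0.
    by rewrite mulr_ge0 ?(dr w).1// ltW.
  case: (c =P a) => [->|_] /=.
    by rewrite (negbTE ab) /= subr0 mul1r subr_ge0.
  case: (c =P b) => [->|_] /=; last by rewrite subrr mul0r.
  by rewrite sub0r mulN1r oppr_ge0 subr_le0.
have := value_le_persuasion AM a0 uS01 dmu dr' ob'.
have -> : value mu uS r' = value mu uS r + mu w * r w b * (uS a w - uS b w).
  rewrite -(sum_delta a (fun c => uS c w)) -(sum_delta b (fun c => uS c w)).
  rewrite -sumrB mulr_sumr.
  rewrite -(sum_delta w (fun v => \sum_c mu v * r w b *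
     ((c == a)%:R * uS c v - (c == b)%:R * uS c v))) /value -big_split/=.
  apply: eq_bigr => v _; rewrite mulr_sumr -big_split/=.
  by apply: eq_bigr => c _; rewrite /r'; ring.
move=> le_pers.
have rb0 : 0 <= r w b by have [] := dr w.
have h1 : mu w * r w b * (uS a w - uS b w) <= theta * d / 4 by lra.
have h2 : d * r w b * 4^-1 <= mu w * r w b * (uS a w - uS b w).
  apply: ler_pM; [|by []| |by lra]; first by rewrite mulr_ge0// ltW.
  by rewrite ler_wpM2r// dP.
have h3 : d * r w b <= d * theta by lra.
by rewrite ler_pM2l in h3.
Qed.

(* Chosen so that [#|A| * (8 * eps) = 1 / 2] in [near_pure]. *)
Definition eps : R := (16 * #|A|%:R)^-1.

(** The Sender's utilities are near [1] at [a], [2^-1] at [b] and [0] elsewhere, so the expected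
    loss relative to [a] is about one minus the probability of [a] minus half that of [b]. *)
Definition diverse a b w :=
  [/\ 1 - eps <= uS a w, 2^-1 - eps <= uS b w <= 2^-1,
      (forall c, c != a -> c != b -> uS c w <= eps),
      (forall c, uR c w <= uR a w) & (forall c, uR b w <= uR c w)].

Lemma card_action_gt0 : 0 < #|A|%:R :> R.
Proof. by rewrite ltr0n; apply/card_gt0P; exists a0. Qed.

Lemma eps_bounds : 0 < eps <= 16^-1.
Proof.
have kk : 1 <= #|A|%:R :> R by rewrite ler1n; apply/card_gt0P; exists a0.
rewrite /eps invr_gt0 mulr_gt0 ?card_action_gt0//= lef_pV2 ?posrE ?mulr_gt0 ?card_action_gt0//.
by rewrite ler_pMr.
Qed.

Section NearPure.
Variables (theta : R) (r : Omega -> A -> R).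
Hypothesis theta0 : 0 < theta.
Hypothesis dr : forall w, is_dist (r w).
Hypothesis ic : forall w w', eu uS r w w' <= eu uS r w w.
Hypothesis small : forall a b w, aligned a b w -> r w b <= theta.
Hypothesis rich : forall a b, a != b -> exists w, diverse a b w.

Lemma loss_eu a w w' : uS a w - eu uS r w w' = \sum_c r w' c * (uS a w - uS c w).
Proof.
rewrite -[uS a w in LHS]mul1r -(dr w').2 mulr_suml -sumrB.
by apply: eq_bigr => c _; ring.
Qed.

Lemma diverse_aligned a b w : a != b -> diverse a b w -> aligned a b w.
Proof.
move=> ab [h1 /andP[h2 h3] _ h4 h5]; split=> //.
by have /andP[] := eps_bounds; lra.
Qed.

(** The left side bounds from below the Sender's loss in [w] under its own outcome, where [b] has
    mass at most [theta]; the right side bounds from above the loss from mimicking [v]. Incentive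
    compatibility orders the two losses. *)
Lemma diverse_pair a b w v : a != b -> diverse a b w ->
  (1 - 2 * eps) * (1 - r w a - theta) <=
  1 - r v a - (2^-1 - eps) * r v b.
Proof.
move=> ab db; have [h1 /andP[h2 h3] h4 _ _] := db.
have /andP[e0 e1] := eps_bounds.
have rb := small (diverse_aligned ab db).
have sum_ind w' c0 k : \sum_c r w' c * ((c == c0)%:R * k) = r w' c0 * k :> R.
  by under eq_bigr do rewrite mulrCA; rewrite sum_delta.
have sum1 w' : \sum_c r w' c = 1 by have [] := dr w'.
have lower : (1 - 2 * eps) * (1 - r w a - r w b) <= uS a w - eu uS r w w.
  rewrite loss_eu.
  have -> : (1 - 2 * eps) * (1 - r w a - r w b) = \sum_c r w c *
     ((1 - 2 * eps) - ((c == a)%:R * (1 - 2 * eps)) - (c == b)%:R * (1 - 2 * eps)).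
    under eq_bigr do rewrite 2!mulrBr.
    by rewrite 2!sumrB !sum_ind -mulr_suml sum1; ring.
  apply: ler_sum => c _; apply: ler_wpM2l; first by have [] := dr w.
  case: (c =P a) => [->|/eqP ca] /=; first by rewrite (negbTE ab) /=; lra.
  case: (c =P b) => [->|/eqP cb] /=; first by lra.
  by have := h4 c ca cb; lra.
have upper : uS a w - eu uS r w v <= 1 - r v a - (2^-1 - eps) * r v b.
  rewrite loss_eu.
  have -> : 1 - r v a - (2^-1 - eps) * r v b = \sum_c r v c *
     (1 - (c == a)%:R * 1 - (c == b)%:R * (2^-1 - eps)).
    under eq_bigr do rewrite 2!mulrBr.
    by rewrite 2!sumrB !sum_ind -mulr_suml sum1; ring.
  apply: ler_sum => c _; apply: ler_wpM2l; first by have [] := dr v.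
  have /andP[? ?] := uS01 a w; have /andP[? ?] := uS01 c w.
  case: (c =P a) => [->|/eqP ca] /=; first by rewrite (negbTE ab) /=; lra.
  by case: (c =P b) => [cb|/eqP cb] /=; [rewrite cb|]; lra.
have mono : (1 - 2 * eps) * (1 - r w a - theta) <= (1 - 2 * eps) * (1 - r w a - r w b).
  by apply: ler_wpM2l; lra.
by have := ic w v; lra.
Qed.

(** Take one diverse state [W b] for each [b != a], and among them the state [W c] most likely to
    lead to [a]. Since no [W b] gains by mimicking [W c], each [b] is rare at [W c] up to a small
    multiple of the total mass outside [a]. Summing over [b], the choice of [eps] absorbs half of
    that mass. *)
Lemma near_pure (a : A) : exists w, 1 - r w a <= 8 * #|A|%:R * theta.
Proof.
have ge0 : 0 <= 8 * #|A|%:R * theta by rewrite !mulr_ge0// ltW.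
have [w0 _] : exists w0 : Omega, True.
  case: (pickP (fun _ : Omega => true)) => [w0 _|none]; first by exists w0.
  have := dmu.2; rewrite big_pred0// => /esym/eqP.
  by rewrite oner_eq0.
have [sB|none] := pselect (exists b, b != a); last first.
  exists w0; have := (dr w0).2; rewrite (bigD1 a)//= big1 ?addr0; first by lra.
  by move=> c ca; exfalso; apply: none; exists c.
have [b0 b0a] := sB.
have /choice[W WP] : forall b, exists w, b != a -> diverse a b w.
  move=> b; have [ba|] := boolP (b != a); last by exists w0.
  by rewrite eq_sym in ba; have [w dw] := rich ba; exists w.
have [c ca cmin] : exists2 c, c != a & forall b, b != a -> r (W b) a <= r (W c) a.
  case: (@arg_maxP _ _ A b0 (fun b => b != a) (fun b => r (W b) a) b0a) => c ca H.
  by exists c.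
exists (W c).
have /andP[e0 e1] := eps_bounds.
have s0 : 0 <= 1 - r (W c) a.
  have [d0 d1] := dr (W c); rewrite -d1 (bigD1 a)//= addrAC subrr add0r.
  exact: sumr_ge0.
(* For [b = c] the state [W c] is itself aligned. Otherwise [W b] is compared with [W c], and
   [2^-1 - eps >= 4^-1] produces the factors 8 and 4. *)
have bnd b : b != a -> r (W c) b <= 8 * eps * (1 - r (W c) a) + 4 * theta.
  move=> ba; have [->|bc] := eqVneq b c.
    have ac : a != c by rewrite eq_sym.
    have := small (diverse_aligned ac (WP c ca)).
    have : 0 <= 8 * eps * (1 - r (W c) a) by rewrite !mulr_ge0// ltW.
    by have := theta0; lra.
  have ab : a != b by rewrite eq_sym.
  have h := diverse_pair (W c) ab (WP b ba).
  have h' : (1 - 2 * eps) * (1 - r (W c) a - theta) <=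
            (1 - 2 * eps) * (1 - r (W b) a - theta).
    by apply: ler_wpM2l; [lra|have := cmin b ba; lra].
  have rb0 : 0 <= r (W c) b by have [] := dr (W c).
  have h2 : 4^-1 * r (W c) b <= (2^-1 - eps) * r (W c) b.
    by apply: ler_wpM2r => //; lra.
  have h3 : 0 <= 2 * eps * theta by rewrite !mulr_ge0// ltW.
  nra.
have : 1 - r (W c) a <= #|A|%:R * (8 * eps * (1 - r (W c) a) + 4 * theta).
  have [d0 d1] := dr (W c); rewrite -{1}d1 (bigD1 a)//= addrAC subrr add0r.
  apply: le_trans (ler_sum _ bnd) _.
  have q0 : 0 <= 8 * eps * (1 - r (W c) a) + 4 * theta.
    by rewrite addr_ge0// !mulr_ge0// ltW.
  rewrite sumr_const -[leLHS]mulr_natl; apply: ler_wpM2r => //.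
  by rewrite ler_nat; exact: max_card.
have -> : #|A|%:R * (8 * eps * (1 - r (W c) a) + 4 * theta) =
    2^-1 * (1 - r (W c) a) + 4 * #|A|%:R * theta.
  by rewrite /eps; field; have := card_action_gt0; rewrite lt0r => /andP[].
lra.
Qed.

End NearPure.

(** Suppose [b] beats [a] by [D > 0] on the cell of [a]. A nearly optimal equilibrium outcome is
    close enough to [pi] in every state that its own obedience bounds this advantage by [D / 2]. *)
Lemma rich_no_value_cell_obedient (pi : {ffun Omega -> A}) :
  (forall w a, a != pi w -> uS a w < uS (pi w) w) ->
  (forall a b, a != b -> exists w, diverse a b w) ->
  commitment_no_value M mu uS uR -> cell_obedient mu uR pi id.
Proof.
move=> best rich nv; apply/forallP => a; apply/forallP => b.
rewrite leNgt; apply/negP; rewrite -subr_gt0 => D0.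
set D := (X in 0 < X) in D0.
have [g g0 gP] := @fin_pos_lbound R (Omega * A)%type (fun p => p.2 != pi p.1)
  (fun p => uS (pi p.1) p.1 - uS p.2 p.1)
  (fun p hp => ltac:(by rewrite subr_gt0; exact: best)).
have k0 := card_action_gt0.
(* Chosen so that the bound of [near_pure] is [D * g / 2], where [g] is the Sender's smallest gap
   between the favourite and another action. *)
pose theta := D * g / (16 * #|A|%:R).
have theta0 : 0 < theta by rewrite divr_gt0// mulr_gt0.
have [r [dr ob ic small]] := no_value_near_optimal theta0 nv.
(* State [w] can mimic the state [v] that leads almost surely to [pi w], so its own loss is as
   small; each unit of mass off [pi w] costs at least [g]. *)
have near w : g * (1 - r w (pi w)) <= D * g / 2.
  have [v vP] := near_pure theta0 dr ic small rich (pi w).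
  have -> : D * g / 2 = 8 * #|A|%:R * theta.
    by rewrite /theta; field; rewrite lt0r_neq0.
  apply: le_trans vP.
  have sumE w' k : k * (1 - r w' (pi w)) = \sum_(c | c != pi w) r w' c * k.
    have [_ d1] := dr w'; rewrite -d1 (bigD1 (pi w))//= addrAC subrr add0r.
    by rewrite mulrC mulr_suml.
  have up : uS (pi w) w - eu uS r w v <= 1 * (1 - r v (pi w)).
    rewrite loss_eu// sumE (bigD1 (pi w))//= subrr mulr0 add0r.
    apply: ler_sum => c _; apply: ler_wpM2l; first by have [] := dr v.
    by have /andP[? ?] := uS01 c w; have /andP[? ?] := uS01 (pi w) w; lra.
  have lo : g * (1 - r w (pi w)) <= uS (pi w) w - eu uS r w w.
    rewrite loss_eu// sumE [leRHS](bigD1 (pi w))//= subrr mulr0 add0r.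
    apply: ler_sum => c hc; apply: ler_wpM2l; first by have [] := dr w.
    exact: (gP (w, c)).
  by have := ic w v; lra.
have near' w : 1 - r w (pi w) <= D / 2.
  by rewrite -(ler_pM2l g0) mulrA [g * D]mulrC; exact: near.
(* Adding the obedience sum of [r] to [D] leaves weights [(pi w == a)%:R - r w a], of absolute value
   at most [1 - r w (pi w)]. *)
have : D <= D / 2; last by lra.
have h := ob a b.
have DE : D = \sum_w mu w * (pi w == a)%:R * (uR b w - uR a w).
  rewrite /D -sumrB big_mkcond/=; apply: eq_bigr => w _.
  by case: eqP => _ /=; ring.
rewrite {1}DE -[leLHS]addr0; apply: le_trans (lerD (lexx _) h) _.
have -> : D / 2 = \sum_w mu w * (D / 2) by rewrite -mulr_suml dmu.2 mul1r.
rewrite -big_split/=; apply: ler_sum => w _.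
have -> : mu w * (pi w == a)%:R * (uR b w - uR a w) + mu w * r w a * (uR a w - uR b w) =
   mu w * (((pi w == a)%:R - r w a) * (uR b w - uR a w)) by ring.
apply: ler_wpM2l; first exact: ltW.
have hn := near' w; have [d0 d1] := dr w.
have /andP[? ?] := uR01 a w; have /andP[? ?] := uR01 b w.
have r1 : r w (pi w) <= 1.
  by rewrite -d1 (bigD1 (pi w))//= lerDl sumr_ge0.
case: (pi w =P a) => [pa|/eqP pa] /=.
  rewrite pa in hn r1.
  by rewrite (le_trans _ hn)// ler_piMr; lra.
have : r w a <= 1 - r w (pi w).
  rewrite -d1 (bigD1 (pi w))//= addrAC subrr add0r (bigD1 a)//=; last by rewrite eq_sym.
  by rewrite lerDl sumr_ge0.
move=> h1; apply: le_trans hn; apply: le_trans h1.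
by rewrite sub0r mulNr -mulrN ler_piMr//; lra.
Qed.

End Necessity.

(** * Measure of the no-value event: symmetry, ties and rich environments *)

Section Environments.
Variables (R : realType) (A Omega M : finType) (mu : Omega -> R) (a0 : A).
Hypothesis AM : (#|A| <= #|M|)%N.
Hypothesis dmu : is_dist mu.
Hypothesis mu_gt0 : forall w, 0 < mu w.
Local Notation T := (env_idx A Omega).
Implicit Types (e : T -> R) (pi : {ffun Omega -> A}) (c : A -> A).

Definition strict_best pi e :=
  [forall w, forall a, (a != pi w) ==> (env_uS e a w < env_uS e (pi w) w)].

Definition best_obedient pi c e := strict_best pi e && cell_obedient mu (env_uR e) pi c.

Definition sender_tie e :=
  [exists w, exists a, exists b, (a != b) && (env_uS e a w == env_uS e b w)].

Definition cell_value pi a e b := \sum_(w | pi w == a) mu w * env_uR e b w.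

(** Only nonempty cells count: on an empty cell all values are zero and every pair of actions would
    tie. *)
Definition receiver_tie e := [exists pi : {ffun Omega -> A}, exists a, exists b, exists b',
  [exists w, pi w == a] && (b != b') && (cell_value pi a e b == cell_value pi a e b')].

Lemma strict_bestP pi e :
  reflect (forall w a, a != pi w -> env_uS e a w < env_uS e (pi w) w) (strict_best pi e).
Proof.
apply: (iffP forallP) => [H w a|H w]; first by have /forallP/(_ a)/implyP := H w.
by apply/forallP => a; apply/implyP; exact: H.
Qed.

Lemma strict_best_inj pi pi' e : strict_best pi e -> strict_best pi' e -> pi = pi'.
Proof.
move=> /strict_bestP H /strict_bestP H'; apply/ffunP => w; apply/eqP.
apply/negPn/negP => ne; have := H' w _ ne; rewrite eq_sym in ne.
by move=> /(lt_trans (H w _ ne)); rewrite ltxx.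
Qed.

Lemma no_tie_strict_best e : ~~ sender_tie e -> exists pi, strict_best pi e.
Proof.
move=> nt.
have /choice[f fP] : forall w, exists a, forall b, env_uS e b w <= env_uS e a w.
  by move=> w; exact: fin_argmax.
exists [ffun w => f w]; apply/strict_bestP => w a; rewrite ffunE => ne.
rewrite lt_neqAle fP andbT; apply: contra nt => eq.
by apply/existsP; exists w; apply/existsP; exists a; apply/existsP; exists (f w); rewrite ne.
Qed.

Lemma sum_best_obedient pi0 c e (p : pred {ffun Omega -> A}) : strict_best pi0 e ->
  \sum_(pi | p pi) (best_obedient pi c e)%:R =
  (p pi0 && cell_obedient mu (env_uR e) pi0 c)%:R :> R.
Proof.
move=> b0; rewrite big_mkcond (bigD1 pi0)//= /best_obedient b0 /= big1 ?addr0.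
  by case: (p pi0).
move=> pi ne; case: ifP => // _; case: (boolP (strict_best pi e)) => // b.
by rewrite (strict_best_inj b b0) eqxx in ne.
Qed.

Lemma rmeas_uS a w : rmeas (fun e : T -> R => env_uS e a w).
Proof. exact: rmeas_proj. Qed.

Lemma rmeas_uR a w : rmeas (fun e : T -> R => env_uR e a w).
Proof. exact: rmeas_proj. Qed.

Lemma bmeas_strict_best pi : bmeas (strict_best pi).
Proof.
apply: bmeas_forall => w; apply: bmeas_forall => a.
case: (a != pi w) => /=; last exact: bmeas_cst.
exact: (bmeas_lt (rmeas_uS a w) (rmeas_uS (pi w) w)).
Qed.

Lemma rmeas_cell_value pi a b : rmeas (fun e => cell_value pi a e b).
Proof.
by apply: rmeas_sum => w; apply: (rmeasM (rmeas_cst (mu w)) (rmeas_uR b w)).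
Qed.

Lemma bmeas_best_obedient pi c : bmeas (best_obedient pi c).
Proof.
apply: (bmeas_and (bmeas_strict_best pi)).
apply: bmeas_forall => a; apply: bmeas_forall => b.
exact: (bmeas_le (rmeas_cell_value pi a b) (rmeas_cell_value pi a (c a))).
Qed.

Lemma rmeas_best_obedient pi c : rmeas (fun e => (best_obedient pi c e)%:R).
Proof. exact/rmeas_ind/bmeas_best_obedient. Qed.

Lemma bmeas_sender_tie1 w a b :
  bmeas (fun e : T -> R => (a != b) && (env_uS e a w == env_uS e b w)).
Proof.
exact: (bmeas_and (bmeas_cst _) (bmeas_eq (rmeas_uS a w) (rmeas_uS b w))).
Qed.

Lemma bmeas_sender_tie : bmeas sender_tie.
Proof.
apply: bmeas_exists => w; apply: bmeas_exists => a; apply: bmeas_exists => b.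
exact: bmeas_sender_tie1.
Qed.

Lemma vol_sender_tie : vol (fun e => (sender_tie e)%:R) = 0%E.
Proof.
apply: vol_exists_null => w.
  by apply: bmeas_exists => a; apply: bmeas_exists => b; exact: bmeas_sender_tie1.
apply: vol_exists_null => a.
  by apply: bmeas_exists => b; exact: bmeas_sender_tie1.
apply: vol_exists_null => b; first exact: bmeas_sender_tie1.
apply: (@vol_thin _ _ _ (true, (a, w)) (@bmeas_sender_tie1 w a b)) => e.
exists (env_uS e b w) => x /andP[ab /eqP].
rewrite /env_uS /upd eqxx; case: eqP => // - [ba].
by rewrite ba eqxx in ab.
Qed.

Lemma bmeas_receiver_tie1 pi a b b' : bmeas (fun e =>
  [exists w, pi w == a] && (b != b') && (cell_value pi a e b == cell_value pi a e b')).
Proof.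
exact: (bmeas_and (bmeas_cst _)
  (bmeas_eq (rmeas_cell_value pi a b) (rmeas_cell_value pi a b'))).
Qed.

Lemma bmeas_receiver_tie : bmeas receiver_tie.
Proof.
apply: bmeas_exists => pi; apply: bmeas_exists => a; apply: bmeas_exists => b.
by apply: bmeas_exists => b'; exact: bmeas_receiver_tie1.
Qed.

Lemma vol_receiver_tie : vol (fun e => (receiver_tie e)%:R) = 0%E.
Proof.
apply: vol_exists_null => pi.
  apply: bmeas_exists => a; apply: bmeas_exists => b; apply: bmeas_exists => b'.
  exact: bmeas_receiver_tie1.
apply: vol_exists_null => a.
  by apply: bmeas_exists => b; apply: bmeas_exists => b'; exact: bmeas_receiver_tie1.
apply: vol_exists_null => b.
  by apply: bmeas_exists => b'; exact: bmeas_receiver_tie1.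
apply: vol_exists_null => b'; first exact: bmeas_receiver_tie1.
have m := @bmeas_receiver_tie1 pi a b b'.
have [[w0 piw0]|nw] := pselect (exists w, pi w = a); last first.
  have -> : [exists w, pi w == a] = false; last exact: (@vol_cst R T 0).
  by apply/existsP => -[w /eqP piw]; apply: nw; exists w.
apply: (@vol_thin _ _ _ (false, (b, w0)) m) => e.
(* The tie is a linear equation in the coordinate [(false, (b, w0))] with nonzero coefficient
   [mu w0]; this is its solution. *)
exists ((cell_value pi a e b' - \sum_(w | (pi w == a) && (w != w0)) mu w * env_uR e b w)
   / mu w0) => x /andP[/andP[_ bb'] /eqP].
have -> : cell_value pi a (upd (false, (b, w0)) x e) b' = cell_value pi a e b'.
  apply: eq_bigr => w _; congr (_ * _); rewrite /env_uR /upd.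
  by case: eqP => // - [b'b]; rewrite b'b eqxx in bb'.
rewrite /cell_value (bigD1 w0)/= ?piw0 ?eqxx//.
rewrite {1}/env_uR /upd eqxx => <-.
rewrite (eq_bigr (fun w => mu w * env_uR e b w)); last first.
  move=> w /andP[_ ne]; congr (_ * _); rewrite /env_uR.
  by case: eqP => // - [ww0]; rewrite ww0 eqxx in ne.
by rewrite addrK mulrAC divff ?mul1r// gt_eqF.
Qed.

(* Swapping the Receiver's utilities of [a] and [c a] on the states where the
   Sender's favourite is [a] maps the event for [id] to the event for [c]. *)
Lemma vol_best_obedient_sym pi c : vol (fun e => (best_obedient pi c e)%:R) =
  vol (fun e => (best_obedient pi id e)%:R).
Proof.
pose h (t : T) : T := let: (i, (a, w)) := t in
  (i, (if i then a else tperm (pi w) (c (pi w)) a, w)).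
have hK : involutive h by case=> [[] [a w]] //=; rewrite tpermK.
rewrite -[RHS](vol_reindex hK hK)//; last exact: rmeas_best_obedient.
congr vol; apply/funext => e; congr (nat_of_bool _)%:R.
rewrite /best_obedient; congr andb.
have uE a b : \sum_(w | pi w == a) mu w * env_uR (e \o h) b w =
    \sum_(w | pi w == a) mu w * env_uR e (tperm a (c a) b) w.
  by apply: eq_bigr => w /eqP <-.
apply: eq_forallb => a; apply/forallP/forallP => H b; rewrite ?uE.
  by rewrite tpermL; exact: H.
by have := H (tperm a (c a) b); rewrite !uE tpermK tpermL.
Qed.

(** All maps [c] contribute the same volume by symmetry, and there are [#|A| ^ #|A|] of them. The
    predicate [p] admits all [pi] for the lower bound and the surjective ones for the upper
    bound. *)
Lemma vol_best_obedient_sum (p : pred {ffun Omega -> A}) :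
  (((#|A| ^ #|A|)%:R)%:E * vol (fun e => (\sum_(pi | p pi) (best_obedient pi id e)%:R)%R) =
  vol (fun e => (\sum_(c : {ffun A -> A}) \sum_(pi | p pi) (best_obedient pi c e)%:R)%R))%E.
Proof.
have ge0 c e : 0 <= \sum_(pi | p pi) (best_obedient pi c e)%:R :> R.
  by apply: sumr_ge0 => pi _; rewrite ler0n.
have ms c : rmeas (fun e => \sum_(pi | p pi) (best_obedient pi c e)%:R).
  by apply: rmeas_sum => pi; exact: rmeas_best_obedient.
rewrite -volZ// vol_sum//.
transitivity (\sum_(c : {ffun A -> A})
    vol (fun e => (\sum_(pi | p pi) (best_obedient pi id e)%:R : R)%R))%E.
  rewrite -vol_sum//; congr vol; apply/funext => e.
  by rewrite sumr_const card_ffun mulr_natl.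
apply: eq_bigr => c _; rewrite !vol_sum//; try by move=> *; rewrite ler0n.
- by apply: eq_bigr => pi _; rewrite vol_best_obedient_sym.
- by move=> pi; exact: rmeas_best_obedient.
- by move=> pi; exact: rmeas_best_obedient.
Qed.

Lemma card_pow_gt0 : 0 < (#|A| ^ #|A|)%:R :> R.
Proof. by rewrite ltr0n expn_gt0; apply/orP; left; apply/card_gt0P; exists a0. Qed.

Lemma no_value_measureE : @no_value_measure R A Omega M mu =
  vol (\1_[set e : T -> R | commitment_no_value M mu (env_uS e) (env_uR e)]).
Proof. by []. Qed.

Lemma no_value_measure_ge :
  (((#|A| ^ #|A|)%:R^-1)%:E <= @no_value_measure R A Omega M mu)%E.
Proof.
apply: (@le_trans _ _ (vol (fun e => \sum_pi (best_obedient pi id e)%:R))); last first.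
  rewrite no_value_measureE; apply: le_vol => e.
    by apply: sumr_ge0 => pi _; rewrite ler0n.
  move=> _; case: (pselect (exists pi, strict_best pi e)) => [[pi b]|none]; last first.
    rewrite big1; first by rewrite indicE ler0n.
    move=> pi _; rewrite /best_obedient; case: (boolP (strict_best pi e)) => // b.
    by exfalso; apply: none; exists pi.
  rewrite (sum_best_obedient id predT b) /= indicE ler_nat.
  case: (boolP (cell_obedient _ _ _ _)) => // ob; rewrite mem_set//=.
  apply: (first_best_no_value AM a0 _ _ ob) => [w|w a]; first exact: ltW.
  by have [->//|/(strict_bestP _ _ b)/ltW] := eqVneq a (pi w).
(* After multiplication by the number of maps, it remains to see that the events for all [c] cover
   the cube up to Sender ties. *)
rewrite -[leLHS]mule1 lee_pdivrMl ?card_pow_gt0// vol_best_obedient_sum.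
set f := fun e : T -> R => _.
have f0 e : 0 <= f e.
  by apply: sumr_ge0 => c _; apply: sumr_ge0 => pi _; rewrite ler0n.
have mf : rmeas f.
  by apply: rmeas_sum => c; apply: rmeas_sum => pi; exact: rmeas_best_obedient.
rewrite -[leRHS]adde0 -vol_sender_tie -volD//; last exact/rmeas_ind/bmeas_sender_tie.
rewrite -[leLHS](@vol_cst R T 1); apply: le_vol => // e _.
have [tie|/no_tie_strict_best[pi b]] := boolP (sender_tie e); first by rewrite lerDr.
rewrite addr0 /f; under eq_bigr do rewrite (sum_best_obedient _ predT b).
have /choice[g gP] : forall a, exists a', forall b',
    cell_value pi a e b' <= cell_value pi a e a'.
  by move=> a; exact: fin_argmax.
rewrite (bigD1 [ffun a => g a])//=.
have -> : cell_obedient mu (env_uR e) pi [ffun a => g a].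
  by apply/forallP => a; apply/forallP => b'; rewrite ffunE; exact: gP.
by rewrite lerDl sumr_ge0// => c _; rewrite ler0n.
Qed.

(** No cell is empty. On an empty cell every choice of [c a] is optimal, so events for different [c]
    would overlap. *)
Definition surj pi := [forall a, exists w, pi w == a].

Lemma vol_surj_best_obedient :
  (vol (fun e => (\sum_(pi | surj pi) (best_obedient pi id e)%:R)%R)
    <= ((#|A| ^ #|A|)%:R^-1)%:E)%E.
Proof.
rewrite -[leRHS]mule1 lee_pdivlMl ?card_pow_gt0// vol_best_obedient_sum.
(* On the null set of Receiver ties, the number of maps [c] whose event holds is bounded crudely by
   the number [K] of all maps. *)
pose K := #|{ffun A -> A}|%:R : R.
apply: (@le_trans _ _ (vol (fun e => 1 + K * (receiver_tie e)%:R))); last first.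
  rewrite volD//; last 2 first.
  - by move=> e; rewrite mulr_ge0// ler0n.
  - exact/(rmeasM (rmeas_cst K))/rmeas_ind/bmeas_receiver_tie.
  rewrite vol_cst volZ ?ler0n//; last exact/rmeas_ind/bmeas_receiver_tie.
  by rewrite vol_receiver_tie mule0 adde0.
apply: le_vol => e; first by apply: sumr_ge0 => c _; apply: sumr_ge0 => pi _; rewrite ler0n.
move=> _; case: (pselect (exists pi, strict_best pi e)) => [[pi b]|none]; last first.
  rewrite big1 ?addr_ge0 ?mulr_ge0 ?ler0n// => c _; rewrite big1// => pi _.
  rewrite /best_obedient; case: (boolP (strict_best pi e)) => // b.
  by exfalso; apply: none; exists pi.
under eq_bigr do rewrite (sum_best_obedient _ _ b).
have [tie|ntie] := boolP (receiver_tie e).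
  rewrite mulr1 -[leLHS]add0r lerD// /K -sumr_const; apply: ler_sum => c _.
  by rewrite lern1 leq_b1.
rewrite mulr0 addr0.
have [sj|_] := boolP (surj pi); last by rewrite big1.
have [[c ob]|none] := pselect (exists c : {ffun A -> A},
    cell_obedient mu (env_uR e) pi c); last first.
  by rewrite big1// => c _; case: (boolP (cell_obedient _ _ _ _)) => // ob;
    exfalso; apply: none; exists c.
(* Two distinct maps that are both optimal differ at some [a], and their values there tie on the
   nonempty cell of [a]. *)
rewrite (bigD1 c)//= ob big1 ?addr0// => c' ne.
case: (boolP (cell_obedient _ _ _ _)) => // ob'; exfalso.
move/negP: ne; apply; apply/eqP/ffunP => a; apply/eqP/negPn/negP => ne.
move/negP: ntie; apply; apply/existsP; exists pi; apply/existsP; exists a.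
apply/existsP; exists (c' a); apply/existsP; exists (c a).
have /forallP/(_ a) -> := sj; rewrite ne /= eq_le.
have /forallP/(_ a)/forallP/(_ (c' a)) := ob; rewrite -/(cell_value _ _ _ _) => ->.
by have /forallP/(_ a)/forallP/(_ (c a)) := ob'.
Qed.

(** Lower ends of intervals of length [eps] whose product consists of diverse states: for the Sender
    near [1] at [a], [2^-1] at [b], [0] elsewhere; for the Receiver near [1] at [a], [0] at [b],
    [2^-1] elsewhere. *)
Definition lo (a b : A) (t : T) : R := let: (i, (d, _)) := t in
  if d == a then 1 - eps R A
  else if i then (if d == b then 2^-1 - eps R A else 0)
  else (if d == b then 0 else 2^-1 - eps R A).

Definition in_box a b w e :=
  [forall t : T, (t.2.2 == w) ==> (lo a b t <= e t <= lo a b t + eps R A)].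

(** A count of missed pairs rather than an indicator, as suits a union bound; the diagonal pairs
    only enlarge it. *)
Definition not_rich e := \sum_(ab : A * A) [forall w, ~~ in_box ab.1 ab.2 w e]%:R : R.

Lemma bmeas_miss_box a b : bmeas (fun e => [forall w, ~~ in_box a b w e]).
Proof.
apply: bmeas_forall => w; apply/bmeas_neg/bmeas_forall => t.
case: (t.2.2 == w) => /=; last exact: bmeas_cst.
exact: (bmeas_and (bmeas_le (rmeas_cst _) (rmeas_proj t))
  (bmeas_le (rmeas_proj t) (rmeas_cst _))).
Qed.

Lemma in_box_diverse a b w e : a != b -> in_box a b w e ->
  diverse (env_uS e) (env_uR e) a b w.
Proof.
move=> ab /forallP box.
have uSP d : lo a b (true, (d, w)) <= env_uS e d w <= lo a b (true, (d, w)) + eps R A.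
  by have := box (true, (d, w)); rewrite eqxx.
have uRP d : lo a b (false, (d, w)) <= env_uR e d w <= lo a b (false, (d, w)) + eps R A.
  by have := box (false, (d, w)); rewrite eqxx.
have /andP[e0 e1] := eps_bounds R a0.
have ba : (b == a) = false by rewrite eq_sym; exact: negbTE.
split.
- by have /andP[] := uSP a; rewrite /lo eqxx.
- by have := uSP b; rewrite /lo ba eqxx subrK.
- by move=> d /negbTE da /negbTE db; have /andP[_] := uSP d; rewrite /lo da db add0r.
- move=> d; have /andP[+ _] := uRP a; rewrite /lo eqxx.
  have [->//|da] := eqVneq d a.
  by have /andP[_] := uRP d; rewrite /lo (negbTE da); case: ifP => _; lra.
- move=> d; have /andP[_] := uRP b; rewrite /lo ba eqxx.
  have [->//|db] := eqVneq d b.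
  by have /andP[+ _] := uRP d; rewrite /lo (negbTE db); case: ifP => _; lra.
Qed.

(** Each state owns a block of [2 * #|A|] coordinates, and distinct states miss their boxes
    independently. *)
Lemma vol_not_rich : (vol not_rich <=
  ((#|A| ^ 2)%:R * (1 - eps R A ^+ (2 * #|A|)) ^+ #|Omega|)%:E)%E.
Proof.
have /andP[e0 e1] := eps_bounds R a0.
rewrite /not_rich vol_sum; last 2 first.
- by move=> ab e; rewrite ler0n.
- by move=> ab; exact/rmeas_ind/bmeas_miss_box.
have bnd (ab : A * A) : (vol (fun e => [forall w, ~~ in_box ab.1 ab.2 w e]%:R) <=
    ((1 - eps R A ^+ (2 * #|A|)) ^+ #|Omega|)%:E)%E.
  apply: (@vol_miss_boxes R T Omega (fun t => t.2.2) (lo ab.1 ab.2) (eps R A)).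
  - by lra.
  - by move=> [i [d w]] /=; case: ifP => _; case: i; try case: ifP => _; lra.
  - move=> w; pose f (p : bool * A) : T := (p.1, (p.2, w)).
    have finj : injective f by move=> [i a] [j b] [-> ->].
    rewrite -[in RHS]card_bool -card_prod -(card_codom finj).
    apply: eq_card => [[i [d v]]]; rewrite !inE /=; apply/eqP/codomP => [->|[[j b] [_ _]]//].
    by exists (i, d).
apply: le_trans (lee_sum _ (fun ab _ => bnd ab)) _.
by rewrite sumEFin sumr_const card_prod mulnn mulr_natl.
Qed.

Lemma no_value_measure_le : (@no_value_measure R A Omega M mu <=
  ((#|A| ^ #|A|)%:R^-1 +
   (#|A| ^ 2)%:R * (1 - eps R A ^+ (2 * #|A|)) ^+ #|Omega|)%:E)%E.
Proof.
have /andP[e0 e1] := eps_bounds R a0.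
rewrite EFinD; apply: le_trans (leeD vol_surj_best_obedient vol_not_rich).
have nr0 e : 0 <= not_rich e by apply: sumr_ge0 => ab _; rewrite ler0n.
have mnr : rmeas not_rich.
  by apply: rmeas_sum => ab; exact/rmeas_ind/bmeas_miss_box.
set f := fun e : T -> R => \sum_(pi | surj pi) _.
have f0 e : 0 <= f e by apply: sumr_ge0 => pi _; rewrite ler0n.
have mf : rmeas f by apply: rmeas_sum => pi; exact: rmeas_best_obedient.
rewrite -[leRHS]adde0 -vol_sender_tie -volD// -volD//; last 3 first.
- by move=> e; rewrite addr_ge0.
- exact: rmeasD.
- exact/rmeas_ind/bmeas_sender_tie.
rewrite no_value_measureE; apply: le_vol => e; first by rewrite indicE ler0n.
move=> ce.
have [tie|/no_tie_strict_best[pi b]] := boolP (sender_tie e).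
  by rewrite indicE -[leLHS]add0r lerD ?addr_ge0//; case: (_ \in _); rewrite ?ler01.
rewrite addr0 indicE.
have [nv|nv] := pselect (commitment_no_value M mu (env_uS e) (env_uR e)); last first.
  by rewrite memNset//= addr_ge0.
rewrite mem_set//=.
case: (pselect (exists a b, a != b /\ forall w, ~~ in_box a b w e)) => [[a [a' [_ H]]]|rich].
  rewrite -[leLHS]add0r lerD// /not_rich (bigD1 (a, a'))//=.
  have -> : [forall w, ~~ in_box a a' w e] by apply/forallP.
  by rewrite lerDl; apply: sumr_ge0 => ab _; rewrite ler0n.
have {}rich a a' : a != a' -> exists w, diverse (env_uS e) (env_uR e) a a' w.
  move=> ne; apply: contrapT => none; apply: rich; exists a, a'; split=> // w.
  by apply/negP => /(in_box_diverse ne) d; apply: none; exists w.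
rewrite -[leLHS]addr0 lerD// /f (sum_best_obedient _ _ b).
have best := strict_bestP _ _ b.
have -> : cell_obedient mu (env_uR e) pi id.
  by apply: (rich_no_value_cell_obedient a0 AM dmu mu_gt0 _ _ best rich nv);
    move=> a w; exact: ce.
(* A diverse state for [a] and [b'] has [a] as the Sender's favourite, so richness makes every cell
   nonempty. If [a] is the only action, any state will do. *)
suff -> : surj pi by [].
apply/forallP => a; apply/existsP.
have [[b' ne]|none] := pselect (exists b', a != b').
  have [w [h1 /andP[h2 h3] h4 _ _]] := rich _ _ ne; exists w.
  rewrite eq_sym; apply/negPn/negP => /(best w).
  have [->|pb] := eqVneq (pi w) b'; first by lra.
  have [->|pa] := eqVneq (pi w) a; first by rewrite ltxx.
  by have := h4 _ pa pb; lra.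
case: (pickP (fun _ : Omega => true)) => [w _|no].
  exists w; rewrite eq_sym; apply/negPn/negP => ne; apply: none; by exists (pi w).
have := dmu.2; rewrite big_pred0// => /esym/eqP.
by rewrite oner_eq0.
Qed.

End Environments.

(** * The limit of many states *)

Lemma cvg_pow_unbounded (R : realType) (q : R) (m : nat -> nat) :
  0 <= q < 1 ->
  (forall K, exists N, forall n, (N <= n)%N -> (K <= m n)%N) ->
  q ^+ m n @[n --> \oo] --> (0 : R).
Proof.
move=> /andP[q0 q1] mP.
have mcvg : m n @[n --> \oo] --> \oo.
  move=> P [K _ KP]; have [N NP] := mP K; exists N => // n /= Nn.
  by apply: KP; exact: NP.
apply: (cvg_comp _ _ mcvg (cvg_expr _)).
by rewrite ger0_norm.
Qed.

Theorem theorem3 (R : realType) (A : finType) (hA : (0 < #|A|)%N) :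
  (* (i) *)
  (forall (Omega M : finType) (mu0 : Omega -> R),
     (0 < #|Omega|)%N ->
     is_dist mu0 -> (forall w, 0 < mu0 w) ->
     (maxn #|Omega| #|A| < #|M|)%N ->
     (((#|A| ^ #|A|)%:R^-1)%:E <= @no_value_measure R A Omega M mu0)%E)
  /\
  (* (ii) *)
  (forall (Omega : nat -> finType) (M : nat -> finType)
          (mu0 : forall n, Omega n -> R),
     (forall K : nat, exists N : nat, forall n, (N <= n)%N -> (K <= #|Omega n|)%N) ->
     (forall n, is_dist (mu0 n)) -> (forall n w, 0 < mu0 n w) ->
     (forall n, (maxn #|Omega n| #|A| < #|M n|)%N) ->
     (fun n => @no_value_measure R A (Omega n) (M n) (mu0 n)) @ \oo -->
       ((#|A| ^ #|A|)%:R^-1)%:E).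
Proof.
have [a0 _] := card_gt0P hA.
split.
  move=> Omega M mu0 _ dmu mu_gt0 AM; apply: no_value_measure_ge => //.
  by apply: leq_trans (ltnW AM); exact: leq_maxr.
move=> Omega M mu0 Omega_oo dmu mu_gt0 AM.
have AM' n : (#|A| <= #|M n|)%N by apply: leq_trans (ltnW (AM n)); exact: leq_maxr.
pose q : R := 1 - eps R A ^+ (2 * #|A|).
have q01 : 0 <= q < 1.
  have /andP[e0 e1] := eps_bounds R a0.
  rewrite subr_ge0 exprn_ile1 ?ltW//=; last by lra.
  by rewrite gtrBl exprn_gt0.
apply: (@squeeze_cvge _ _ _ _ (fun=> ((#|A| ^ #|A|)%:R^-1)%:E) _
  (fun n => ((#|A| ^ #|A|)%:R^-1 + (#|A| ^ 2)%:R * q ^+ #|Omega n|)%:E)).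
- apply: nearW => n; apply/andP; split; first exact: no_value_measure_ge.
  exact: no_value_measure_le.
- exact: cvg_cst.
- apply: cvg_EFin; first exact: nearW.
  rewrite -[X in _ --> X]addr0; apply: cvgD; first exact: cvg_cst.
  rewrite -(mulr0 (#|A| ^ 2)%:R); apply: cvgM; first exact: cvg_cst.
  exact: cvg_pow_unbounded.
Qed.
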